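(* Let $k\in\mathbb Z$, $\mathbb N_k=\{l\in\mathbb Z:l\le k\}$, and let $\xi$ be a random variable with $\mathbb P(\xi=l)=p_l$ for $l\in\mathbb N_k$, where $p_l\ge0$, $\sum_{l\in\mathbb N_k}p_l=1$, $p_k\in(0,1)$. Assume $p_kp_{k-1}>0$ and $\mathbb E|\xi|<\infty$. For $N\ge1$ let $\{\xi_{i,j}(s):1\le i,j\le N,s\ge1\}$ be i.i.d. copies of $\xi$, $X(0)\in\mathbb R^N$, $X_i(t+1)=\max_{1\le j\le N}\{X_j(t)+\xi_{i,j}(t+1)\}$, and $v_N=\lim_{t\to\infty}t^{-1}\max_{i\le N}X_i(t)$ (this limit exists a.s. and is deterministic). Then, with $q_k=1-p_k$, as $N\to\infty$, $$v_N=k-q_k^{N^2}2^N+o(q_k^{N^2}2^N).$$ *)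

(* Defs.v *)
From HB Require Import structures.
From mathcomp Require Import all_boot all_order all_algebra.
From mathcomp Require Import all_classical all_reals all_analysis.
Set Implicit Arguments. Unset Strict Implicit. Unset Printing Implicit Defensive.
Import Order.TTheory GRing.Theory Num.Theory.
Import numFieldNormedType.Exports.
Local Open Scope classical_set_scope.
Local Open Scope ring_scope.

Definition mutually_independent_rvs {d} {T : measurableType d} {R : realType}
  (P : probability T R) (I : eqType) (f : I -> T -> R) : Prop :=
  forall (J : seq I) (B : I -> set R),
    uniq J -> (forall i, measurable (B i)) ->
    P (\big[setI/setT]_(i <- J) (f i @^-1` B i)) =
    (\prod_(i <- J) P (f i @^-1` B i))%E.

(* Maximum of finitely many reals indexed by 'I_N (N >= 1 in all uses;
   conventionally 0 when N = 0). *)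
Definition maxN {R : realType} (N : nat) (f : 'I_N -> R) : R :=
  match [seq f j | j <- enum 'I_N] with
  | [::] => 0
  | a :: s => foldr Num.max a s
  end.

(* The max-plus dynamics X_i(t+1) = max_j { X_j(t) + xi_{i,j}(t+1) }.
   Here xi i j s w stands for xi_{i,j}(s+1)(w) (time shifted by one). *)
Fixpoint maxplusX {T} {R : realType} (N : nat) (X0 : 'I_N -> R)
  (xi : 'I_N -> 'I_N -> nat -> T -> R) (t : nat) (w : T) : 'I_N -> R :=
  match t with
  | 0 => X0
  | t'.+1 => fun i => maxN (fun j => maxplusX X0 xi t' w j + xi i j t' w)
  end.

(* Main.v *)
Require Import Defs.
From HB Require Import structures.
From mathcomp Require Import all_boot all_order all_algebra.
From mathcomp Require Import all_classical all_reals all_analysis.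
From mathcomp Require Import measurable_realfun.
From mathcomp Require Import zify ring lra.
Set Implicit Arguments. Unset Strict Implicit. Unset Printing Implicit Defensive.
Import Order.TTheory GRing.Theory Num.Theory.
Import numFieldNormedType.Exports.
Local Open Scope classical_set_scope.
Local Open Scope ring_scope.

(** Put eta = k - xi >= 0. Then Y = k t - X solves the min-plus recursion
    Y_i(t+1) = min_j (Y_j(t) + eta_ij(t+1)), and k - v_N is the speed g of the
    passage time D_t = min_i Y_i(t).

    Passage times over consecutive time blocks are superadditive, and
    subadditive up to the total noise of one step. Hence
    E D_L <= g L <= E D_L + C for all L. Independence of the blocks gives
    E |D_L - g L| = o(L), and the maximal inequality for stationary sequences
    upgrades this to D_t / t -> g almost surely, with a first moment only.

    Let q = 1 - p_k and let F_t be the set of minimizers of Y(t). If the set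
    S_t of those i with eta_ij(t+1) = 0 for some j in F_t is nonempty, then
    F_(t+1) = S_t; the passage time increases exactly when S_t is empty. So,
    up to a factor 1 + o(1), g is the time average of E q^(N |F_t|). Given F_t,
    the generating function of |S_t| is u |-> (u + (1 - u) q^|F_t|)^N. At
    u = q^N it is, after removing the event that S_t is empty, smallest when
    |F_t| = N, which yields g >= q^(N^2) ((2 - q^N)^N - 1). For the upper bound,
    expanding the N-th power gives for z_a(t) = E q^(a |F_t|) the linear system
    z_a(t+1) <= sum_(b < N) 'C(N, b) (1 - q^a)^b q^(a (N - b)) z_b(t), and
    q^(a N) (1 + (1 + o(1)) ((1 + q^(N - a))^N - 1)) is a supersolution; at
    a = N it is (1 + o(1)) 2^N q^(N^2). *)

(** * Min-plus passage times *)

(** Heuristically, the factor 2^N arises as follows. The front is usually produced by a full front,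
    so it has size b with probability about 'C(N, b) q^(N (N - b)); a front of size b then fails to
    propagate with probability q^(N b). The product is 'C(N, b) q^(N^2) for every b, and the
    binomial coefficients add up. What must be excluded is a substantial contribution of fronts
    whose predecessor was already small.

    The obstacle is an empty S_t, after which the next front is only known to be nonempty. Its
    contribution to E u^|F| is replaced by 0 in the lower estimate and by u in the upper one; the
    latter also absorbs the term b = N of the expansion, so that the system involves only b < N.

    In the law of large numbers, passage times may have infinite variance. Second moments are taken
    only of indicators of j < D_l. Truncation and superadditivity both lose on the same side, which
    bounds the negative part of D_L - g L; then E D_L <= g L turns this into a bound on the absolute
    value. *)

Section MinPlus.
Local Open Scope nat_scope.
Variable n : nat.
Implicit Types (y : {ffun 'I_n.+1 -> nat})
  (e : {ffun 'I_n.+1 * 'I_n.+1 -> nat})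
  (es : seq {ffun 'I_n.+1 * 'I_n.+1 -> nat}).

Definition ffmin y : nat := y [arg min_(i < ord0) y i].

Lemma ffmin_le y i : ffmin y <= y i.
Proof. by rewrite /ffmin; case: arg_minnP => // j _; apply. Qed.

Lemma ffmin_ex y : exists i, ffmin y = y i.
Proof. by exists [arg min_(i < ord0) y i]. Qed.

Lemma leq_ffmin a y : (forall i, a <= y i) -> a <= ffmin y.
Proof. by move=> h; have [i ->] := ffmin_ex y. Qed.

Lemma ffmin_mono y y' : (forall i, y i <= y' i) -> ffmin y <= ffmin y'.
Proof. by move=> h; apply: leq_ffmin => i; apply: leq_trans (h i); apply: ffmin_le. Qed.

Definition minplus_step y e : {ffun 'I_n.+1 -> nat} :=
  [ffun i => ffmin [ffun j => y j + e (i, j)]].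

Definition minplus_run y es := foldl minplus_step y es.

Definition flat a : {ffun 'I_n.+1 -> nat} := [ffun=> a].

Lemma minplus_step_le y e i j : minplus_step y e i <= y j + e (i, j).
Proof. by rewrite ffunE; apply: leq_trans (ffmin_le _ j) _; rewrite ffunE. Qed.

Lemma minplus_step_ex y e i : exists j, minplus_step y e i = y j + e (i, j).
Proof.
by rewrite ffunE; have [j ->] := ffmin_ex [ffun j => y j + e (i, j)]; exists j; rewrite ffunE.
Qed.

Lemma minplus_step_mono y y' e : (forall i, y i <= y' i) ->
  forall i, minplus_step y e i <= minplus_step y' e i.
Proof.
move=> h i; have [j ->] := minplus_step_ex y' e i.
by apply: leq_trans (minplus_step_le _ _ _ j) _; rewrite leq_add2r.
Qed.

Lemma minplus_run_cons y e es :
  minplus_run y (e :: es) = minplus_run (minplus_step y e) es.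
Proof. by []. Qed.

Lemma minplus_run_cat y es es' :
  minplus_run y (es ++ es') = minplus_run (minplus_run y es) es'.
Proof. exact: foldl_cat. Qed.

Lemma minplus_run_rcons y es e :
  minplus_run y (rcons es e) = minplus_step (minplus_run y es) e.
Proof. by rewrite -cats1 minplus_run_cat. Qed.

Lemma minplus_run_mono es : forall y y', (forall i, y i <= y' i) ->
  forall i, minplus_run y es i <= minplus_run y' es i.
Proof.
elim: es => [//|e es ih] y y' h i.
by rewrite !minplus_run_cons; apply: ih; apply: minplus_step_mono.
Qed.

Definition shift a y : {ffun 'I_n.+1 -> nat} := [ffun i => a + y i].

Lemma shiftE a y i : shift a y i = a + y i.
Proof. by rewrite ffunE. Qed.

Lemma minplus_step_shift a y e : minplus_step (shift a y) e = shift a (minplus_step y e).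
Proof.
apply/ffunP => i; rewrite shiftE; apply/eqP; rewrite eqn_leq; apply/andP; split.
  have [j ->] := minplus_step_ex y e i.
  by apply: leq_trans (minplus_step_le _ _ _ j) _; rewrite shiftE addnA.
have [j ->] := minplus_step_ex (shift a y) e i.
by rewrite shiftE -addnA leq_add2l minplus_step_le.
Qed.

Lemma minplus_run_shift a es : forall y, minplus_run (shift a y) es = shift a (minplus_run y es).
Proof.
elim: es => [//|e es ih] y.
by rewrite !minplus_run_cons minplus_step_shift ih.
Qed.

Lemma ffmin_shift a y : ffmin (shift a y) = a + ffmin y.
Proof.
apply/eqP; rewrite eqn_leq; apply/andP; split.
  by have [j ->] := ffmin_ex y; apply: leq_trans (ffmin_le _ j) _; rewrite shiftE.
by apply: leq_ffmin => i; rewrite shiftE leq_add2l ffmin_le.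
Qed.

Definition passage es : nat := ffmin (minplus_run (flat 0) es).

Definition entry_sum e : nat := \sum_p e p.

Lemma flatE a : flat a = shift a (flat 0).
Proof. by apply/ffunP => i; rewrite !ffunE addn0. Qed.

Lemma passage_nil : passage [::] = 0.
Proof. by rewrite /passage /=; have [i ->] := ffmin_ex (flat 0); rewrite ffunE. Qed.

(** By monotonicity the state after [es] may be lowered to the constant equal to its minimum, and by
    equivariance under constants the restart merely adds that constant. *)
Lemma passage_superadd es es' : passage es + passage es' <= passage (es ++ es').
Proof.
rewrite /passage minplus_run_cat -ffmin_shift -minplus_run_shift -flatE.
by apply: ffmin_mono; apply: minplus_run_mono => i; rewrite ffunE ffmin_le.
Qed.

(** After the step [e], coordinate i is at most the old minimum plus the entry (i, j) at a minimizer
    j. Summing all entries is crude, but removes i and j and stays integrable. [e] is kept in the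
    last term so that it is the passage time of a whole block. *)
Lemma passage_subadd es e es' :
  passage (es ++ e :: es') <= passage es + entry_sum e + passage (e :: es').
Proof.
rewrite /passage minplus_run_cat !minplus_run_cons.
set y := minplus_run _ es.
apply: (@leq_trans (ffmin (minplus_run (flat (ffmin y + entry_sum e)) es'))).
  apply: ffmin_mono; apply: minplus_run_mono => i; rewrite [X in _ <= X]ffunE.
  have [j ->] := ffmin_ex y; apply: leq_trans (minplus_step_le _ _ _ j) _.
  by rewrite leq_add2l /entry_sum (bigD1 (i, j)) //= leq_addr.
rewrite flatE minplus_run_shift ffmin_shift leq_add2l.
by apply: ffmin_mono; apply: minplus_run_mono => i; rewrite ffunE.
Qed.

Lemma passage_cons e es : passage (e :: es) <= entry_sum e + passage es.
Proof.
rewrite /passage !minplus_run_cons -ffmin_shift -minplus_run_shift -flatE.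
apply: ffmin_mono; apply: minplus_run_mono => i; rewrite [X in _ <= X]ffunE.
apply: leq_trans (minplus_step_le _ _ _ i) _.
by rewrite ffunE add0n /entry_sum (bigD1 (i, i)) //= leq_addr.
Qed.

Lemma passage_rcons es e : passage es <= passage (rcons es e).
Proof. by rewrite -cats1; apply: leq_trans (passage_superadd _ _); apply: leq_addr. Qed.

Definition front y : {set 'I_n.+1} := finset (fun i => y i == ffmin y).

Definition hit (F : {set 'I_n.+1}) e : {set 'I_n.+1} :=
  finset (fun i => [exists j in F, e (i, j) == 0]).

Lemma front_gt0 y : 0 < #|front y|.
Proof. by apply/card_gt0P; have [i h] := ffmin_ex y; exists i; rewrite inE h. Qed.

Lemma ffmin_step y e : ffmin y <= ffmin (minplus_step y e).
Proof.
apply: leq_ffmin => i; have [j ->] := minplus_step_ex y e i.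
by apply: leq_trans (ffmin_le y j) _; apply: leq_addr.
Qed.

Lemma ffmin_step_hit y e :
  (ffmin y < ffmin (minplus_step y e)) = (hit (front y) e == finset.set0).
Proof.
apply/idP/eqP => [h|h].
  apply/setP => i; rewrite !inE; apply/negbTE/existsP => -[j /andP[]].
  rewrite inE => /eqP yj /eqP e0.
  have := leq_trans h (ffmin_le _ i).
  by rewrite ltnNge -yj -[X in _ <= X]addn0 -e0 minplus_step_le.
have [i ->] := ffmin_ex (minplus_step y e).
have [j ->] := minplus_step_ex y e i.
have := finset.in_set0 i; rewrite -h inE => /negbT; rewrite negb_exists => /forallP /(_ j).
rewrite inE negb_and; have := ffmin_le y j.
by move: (y j) (e (i, j)) (ffmin y) => a b c; lia.
Qed.

Lemma front_step y e : hit (front y) e != finset.set0 ->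
  front (minplus_step y e) = hit (front y) e.
Proof.
rewrite -ffmin_step_hit -leqNgt => h.
have {h}m : ffmin (minplus_step y e) = ffmin y by apply/eqP; rewrite eqn_leq h ffmin_step.
apply/setP => i; rewrite !inE m; apply/eqP/existsP => [h|[j]].
  have [j hj] := minplus_step_ex y e i; exists j; rewrite inE.
  by have := ffmin_le y j; move: h; rewrite hj; move: (y j) (e (i, j)) (ffmin y) => a b c; lia.
rewrite inE => /andP[/eqP yj /eqP e0]; apply/eqP; rewrite eqn_leq -{2}m ffmin_le andbT.
by rewrite -yj -[X in _ <= X]addn0 -e0 minplus_step_le.
Qed.

(** An entry at most l in a column of the front would cap the new minimum. This controls the size of
    an increase, not only its occurrence. *)
Lemma ffmin_step_ltP y e l : l < ffmin (minplus_step y e) - ffmin y ->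
  [forall i, forall j in front y, l < e (i, j)].
Proof.
move=> h; apply/forallP => i; apply/forallP => j; apply/implyP; rewrite inE => /eqP yj.
have := ffmin_le (minplus_step y e) i; have := minplus_step_le y e i j.
by move: h yj; move: (y j) (e (i, j)) (ffmin y) (ffmin _) (minplus_step _ _ _) => a b c a' b'; lia.
Qed.

End MinPlus.

(** * Discrete random variables *)

Section DiscreteLaws.
Context (d : measure_display) (T : measurableType d) (R : realType) (P : probability T R).

Definition prob (A : set T) : R := fine (P A).

Lemma probE (A : set T) : measurable A -> P A = (prob A)%:E.
Proof. by move=> mA; rewrite /prob fineK // fin_num_measure. Qed.

Lemma prob_ge0 (A : set T) : 0 <= prob A.
Proof. exact: fine_ge0. Qed.

Lemma prob_le (A B : set T) : measurable A -> measurable B -> A `<=` B -> prob A <= prob B.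
Proof. by move=> mA mB AB; rewrite -lee_fin -!probE // le_measure ?inE. Qed.

Lemma prob_le1 (A : set T) : measurable A -> prob A <= 1.
Proof. by move=> mA; rewrite -lee_fin -probE // probability_le1. Qed.

(** All preimages are required, not only those of a sigma-algebra, so that any function of such a
    variable is again one. *)
Definition discrete_rv (C : Type) (A : T -> C) := forall X : set C, measurable (A @^-1` X).

Lemma discrete_rv_fibers (C : countType) (A : T -> C) :
  (forall c, measurable (A @^-1` [set c])) -> discrete_rv A.
Proof.
move=> mA X.
rewrite (_ : _ @^-1` _ = \bigcup_c (A @^-1` ([set c] `&` X))).
  apply: countable_bigcupT_measurable => // c.
  have [Xc|Xc] := pselect (X c).
    by rewrite (_ : _ `&` _ = [set c]) //; apply/seteqP; split => x [] // ->.
  rewrite (_ : _ `&` _ = set0) ?preimage_set0 //.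
  by apply/seteqP; split => x [] // ->.
by apply/seteqP; split => [w Xw|w [c _ []]] //; exists (A w).
Qed.

Lemma discrete_rv_comp (C C' : Type) (A : T -> C) (f : C -> C') :
  discrete_rv A -> discrete_rv (f \o A).
Proof. by move=> mA X; rewrite comp_preimage; apply: mA. Qed.

Lemma discrete_rv_pair (C C' : countType) (A : T -> C) (A' : T -> C') :
  discrete_rv A -> discrete_rv A' -> discrete_rv (fun w => (A w, A' w)).
Proof.
move=> mA mA'; apply: discrete_rv_fibers => -[c c'].
rewrite (_ : _ @^-1` _ = (A @^-1` [set c]) `&` (A' @^-1` [set c'])).
  exact: measurableI.
by apply/seteqP; split => w /= [<- <-].
Qed.

(** The factor [s] and the events [G], [G'] let one summation over fibres serve twice: equality of
    laws is [s = 1] with full events, and independence takes for [s] the probability of an event of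
    the other variable. *)
Lemma prob_fibers (C C' : countType) (A : T -> C) (A' : T -> C) (G G' : set T) (s : R) :
  discrete_rv A -> discrete_rv A' -> measurable G -> measurable G' -> 0 <= s ->
  (forall c, prob (A @^-1` [set c] `&` G) = s * prob (A' @^-1` [set c] `&` G')) ->
  forall X, prob (A @^-1` X `&` G) = s * prob (A' @^-1` X `&` G').
Proof.
move=> mA mA' mG mG' s0 h X.
pose D (c : C) : nat -> set C := fun m => [set c | X c /\ pickle c = m].
have split_nat (B : T -> C) (V : set T) : discrete_rv B -> measurable V ->
    P (B @^-1` X `&` V) = (\sum_(m <oo) P (B @^-1` [set c | X c /\ pickle c = m] `&` V))%E.
  move=> mB mV.
  rewrite (_ : B @^-1` X `&` V = \bigcup_m (B @^-1` [set c | X c /\ pickle c = m] `&` V)).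
    rewrite measure_bigcup //.
      by apply: eq_eseriesl => m; rewrite in_setT.
    - by move=> m _; apply: measurableI.
    - by move=> i j _ _ [w [[[_ <-] _] [[_ <-] _]]].
  by apply/seteqP; split => [w [Xw Vw]|w [m _ [[Xw _] Vw]]] //; exists (pickle (B w)).
apply: EFin_inj; rewrite EFinM -!probE; do ?[exact: measurableI].
rewrite !split_nat // -nneseriesZl //.
apply: eq_eseriesr => m _.
have mI (B : T -> C) V : discrete_rv B -> measurable V ->
  measurable (B @^-1` [set c | X c /\ pickle c = m] `&` V) by move=> *; apply: measurableI.
have [[c [Xc cm]]|nc] := pselect (exists c, X c /\ pickle c = m).
  rewrite (_ : [set c | _] = [set c]); first by rewrite !probE ?h ?EFinM //; apply: measurableI.
  apply/seteqP; split => [c' [_ c'm]|_ ->] //=.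
  by apply: (pcan_inj pickleK); rewrite c'm.
rewrite (_ : [set c | _] = set0); last first.
  by apply/seteqP; split => c //= hc; apply: nc; exists c.
by rewrite !preimage_set0 !set0I !measure0 mule0.
Qed.

Lemma prob_eq_law (C : countType) (A A' : T -> C) :
  discrete_rv A -> discrete_rv A' ->
  (forall c, prob (A @^-1` [set c]) = prob (A' @^-1` [set c])) ->
  forall X, prob (A @^-1` X) = prob (A' @^-1` X).
Proof.
move=> mA mA' h X.
have := @prob_fibers C C A A' setT setT 1 mA mA' measurableT measurableT ler01.
by move=> /(_ _ X); rewrite !setIT mul1r; apply => c; rewrite !setIT mul1r.
Qed.

Lemma prob_indep (C C' : countType) (A : T -> C) (B : T -> C') :
  discrete_rv A -> discrete_rv B ->
  (forall a b, prob (A @^-1` [set a] `&` B @^-1` [set b]) =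
               prob (A @^-1` [set a]) * prob (B @^-1` [set b])) ->
  forall X Y, prob (A @^-1` X `&` B @^-1` Y) = prob (A @^-1` X) * prob (B @^-1` Y).
Proof.
move=> mA mB h X Y.
have h1 b : forall X, prob (A @^-1` X `&` B @^-1` [set b]) =
    prob (B @^-1` [set b]) * prob (A @^-1` X `&` setT).
  apply: prob_fibers => //; first exact: prob_ge0.
  by move=> c; rewrite setIT mulrC h.
have h2 : forall Y, prob (B @^-1` Y `&` A @^-1` X) =
    prob (A @^-1` X) * prob (B @^-1` Y `&` setT).
  apply: prob_fibers => //; first exact: prob_ge0.
  by move=> c; rewrite setIC h1 !setIT mulrC.
by rewrite setIC h2 setIT.
Qed.

Lemma prob_fin_sum (V : finType) (A : T -> V) (X : pred V) (G : set T) :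
  discrete_rv A -> measurable G ->
  prob ([set w | X (A w)] `&` G) = \sum_(v | X v) prob (A @^-1` [set v] `&` G).
Proof.
move=> mA mG; apply: EFin_inj; rewrite -probE; last exact: measurableI (mA [set v | X v]) mG.
rewrite (_ : _ `&` G = \bigcup_(v in [set` enum X]) (A @^-1` [set v] `&` G)); last first.
  apply/seteqP; split => [w [Xw Gw]|w [v /= Xv [/= Aw Gw]]].
    by exists (A w) => //=; rewrite mem_enum.
  by split => //=; rewrite Aw; rewrite mem_enum in Xv.
rewrite measure_fin_bigcup; first last.
- by move=> v _; apply: measurableI.
- by move=> i j _ _ [w [[/= <- _] [/= <- _]]].
- exact: finite_finset.
rewrite -fsbig_seq ?enum_uniq // big_enum /= -sumEFin.
by apply: eq_bigr => v _; rewrite probE //; apply: measurableI.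
Qed.

Definition fmean (V : finType) (A : T -> V) (f : V -> R) : R :=
  \sum_v prob (A @^-1` [set v]) * f v.

Lemma fmean_prob (V : finType) (A : T -> V) (X : pred V) : discrete_rv A ->
  fmean A (fun v => (X v)%:R) = prob [set w | X (A w)].
Proof.
move=> mA; have := prob_fin_sum X mA measurableT; rewrite setIT => ->.
rewrite /fmean [RHS]big_mkcond /=; apply: eq_bigr => v _.
by rewrite setIT; case: (X v); rewrite ?mulr1 ?mulr0.
Qed.

Lemma fmean_cst (V : finType) (A : T -> V) (c : R) : discrete_rv A ->
  fmean A (fun=> c) = c.
Proof.
move=> mA; have := fmean_prob xpredT mA.
rewrite /fmean -!mulr_suml (_ : [set w | _] = setT); last exact/seteqP.
by rewrite /prob probability_setT mulr1 => ->; rewrite mul1r.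
Qed.

(** The comparison is asked only at values taken by [A], the others having probability 0. This
    matters for bounds that fail on arbitrary sets, such as nonemptiness of the front. *)
Lemma fmean_le (V : finType) (A : T -> V) (f g : V -> R) :
  (forall w, f (A w) <= g (A w)) -> fmean A f <= fmean A g.
Proof.
move=> fg; apply: ler_sum => v _.
have [[w <-]|nw] := pselect (exists w, A w = v).
  by rewrite ler_wpM2l // prob_ge0.
rewrite (_ : A @^-1` _ = set0); first by rewrite /prob measure0 !mul0r.
by apply/seteqP; split => w //= hw; apply: nw; exists w.
Qed.

Lemma fmeanD (V : finType) (A : T -> V) (f g : V -> R) :
  fmean A (fun v => f v + g v) = fmean A f + fmean A g.
Proof. by rewrite /fmean -big_split; apply: eq_bigr => v _; rewrite mulrDr. Qed.

Lemma fmeanZ (V : finType) (A : T -> V) (c : R) (f : V -> R) :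
  fmean A (fun v => c * f v) = c * fmean A f.
Proof. by rewrite /fmean mulr_sumr; apply: eq_bigr => v _; rewrite mulrCA. Qed.

Lemma fmean_affine (V : finType) (A : T -> V) (c : R) (f g : V -> R) :
  fmean A (fun v => f v + c * g v) = fmean A f + c * fmean A g.
Proof. by rewrite fmeanD fmeanZ. Qed.

Lemma fmean_sum (V : finType) (A : T -> V) (I : Type) (s : seq I) (Q : pred I) (f : I -> V -> R) :
  fmean A (fun v => \sum_(i <- s | Q i) f i v) = \sum_(i <- s | Q i) fmean A (f i).
Proof.
rewrite /fmean [RHS]exchange_big /=; apply: eq_bigr => v _.
by rewrite mulr_sumr.
Qed.

Lemma fmean_comp (V V' : finType) (A : T -> V) (h : V -> V') (f : V' -> R) :
  discrete_rv A -> fmean (h \o A) f = fmean A (f \o h).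
Proof.
move=> mA; rewrite /fmean [RHS](partition_big h xpredT) //=.
apply: eq_bigr => v' _.
have := prob_fin_sum [pred v | h v == v'] mA measurableT.
rewrite setIT (_ : [set w | _] = (h \o A) @^-1` [set v']).
  move=> ->; rewrite mulr_suml; apply: eq_bigr => v /eqP hv.
  by rewrite setIT hv.
by apply/seteqP; split => w /= /eqP.
Qed.

(** Conditioning on [A] without conditional expectations: on the fibre over v the event only
    concerns [B], and independence factors it. *)
Lemma prob_freeze (V : finType) (C : countType) (A : T -> V) (B : T -> C) (Q : V -> set C) :
  discrete_rv A -> discrete_rv B ->
  (forall a b, prob (A @^-1` [set a] `&` B @^-1` [set b]) =
               prob (A @^-1` [set a]) * prob (B @^-1` [set b])) ->
  prob [set w | Q (A w) (B w)] = fmean A (fun v => prob (B @^-1` Q v)).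
Proof.
move=> mA mB h.
have mG : measurable [set w | Q (A w) (B w)].
  exact: (discrete_rv_pair mA mB [set ab | Q ab.1 ab.2]).
set G := [set w | _].
have -> : G = [set w | xpredT (A w)] `&` G by apply/seteqP; split => w // [].
rewrite (prob_fin_sum xpredT mA mG); apply: eq_bigr => v _.
rewrite -(prob_indep mA mB h); congr prob.
by apply/seteqP; split => w /= [<-].
Qed.

Definition nnint (f : T -> R) : Prop :=
  [/\ (forall w, 0 <= f w), measurable_fun setT f & (\int[P]_w (f w)%:E < +oo)%E].

Definition mean (f : T -> R) : R := fine (\int[P]_w (f w)%:E).

Lemma meanE (f : T -> R) : nnint f -> (\int[P]_w (f w)%:E)%E = (mean f)%:E.
Proof.
case=> f0 mf fi; rewrite /mean fineK // ge0_fin_numE //.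
by apply: integral_ge0 => w _; rewrite lee_fin.
Qed.

Lemma mean_ge0 (f : T -> R) : (forall w, 0 <= f w) -> 0 <= mean f.
Proof. by move=> f0; apply: fine_ge0; apply: integral_ge0 => w _; rewrite lee_fin. Qed.

Lemma nnint_le (f g : T -> R) : nnint g -> measurable_fun setT f -> (forall w, 0 <= f w <= g w) ->
  nnint f /\ mean f <= mean g.
Proof.
move=> hg mf fg; have [g0 mg gi] := hg.
have le : (\int[P]_w (f w)%:E <= \int[P]_w (g w)%:E)%E.
  apply: ge0_le_integral => //.
  - by move=> w _; rewrite lee_fin; case/andP: (fg w).
  - exact/measurable_EFinP.
  - exact/measurable_EFinP.
  - by move=> w _; rewrite lee_fin; case/andP: (fg w).
have hf : nnint f.
  by split => //; [move=> w; case/andP: (fg w)|apply: le_lt_trans gi].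
by split => //; rewrite -lee_fin -!meanE.
Qed.

Lemma nnintD (f g : T -> R) : nnint f -> nnint g ->
  nnint (fun w => f w + g w) /\ mean (fun w => f w + g w) = mean f + mean g.
Proof.
move=> hf hg; have [f0 mf fi] := hf; have [g0 mg gi] := hg.
have e : (\int[P]_w (f w + g w)%:E = (mean f + mean g)%:E)%E.
  under eq_integral do rewrite EFinD.
  rewrite ge0_integralD //.
  - by rewrite !meanE.
  - by move=> w _; rewrite lee_fin.
  - exact/measurable_EFinP.
  - by move=> w _; rewrite lee_fin.
  - exact/measurable_EFinP.
split; last by rewrite /mean e.
split; first by move=> w; apply: addr_ge0.
  exact: measurable_funD.
by rewrite e ltry.
Qed.

Lemma nnintZ (c : R) (f : T -> R) : 0 <= c -> nnint f ->
  nnint (fun w => c * f w) /\ mean (fun w => c * f w) = c * mean f.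
Proof.
move=> c0 hf; have [f0 mf fi] := hf.
have e : (\int[P]_w (c * f w)%:E = (c * mean f)%:E)%E.
  under eq_integral do rewrite EFinM.
  rewrite ge0_integralZl_EFin //.
  - by rewrite meanE.
  - by move=> w _; rewrite lee_fin.
  - exact/measurable_EFinP.
split; last by rewrite /mean e.
split; first by move=> w; apply: mulr_ge0.
  exact: measurable_funM.
by rewrite e ltry.
Qed.

Lemma nnint_bool (b : T -> bool) : measurable [set w | b w] ->
  nnint (fun w => (b w)%:R) /\ mean (fun w => (b w)%:R) = prob [set w | b w].
Proof.
move=> mb.
have e0 : (fun w => (b w)%:R : R) = \1_[set w | b w].
  by apply/funext => w; rewrite indicE; congr (_%:R); rewrite mem_setE.
have e : (\int[P]_w ((b w)%:R)%:E = (prob [set w | b w])%:E)%E.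
  by rewrite -probE //; have := integral_indic P measurableT mb; rewrite setIT => <-; rewrite -e0.
split; last by rewrite /mean e.
split; first by [].
  by rewrite e0; apply: measurable_indic.
by rewrite e ltry.
Qed.

Lemma nnint_cst (c : R) : 0 <= c -> nnint (fun=> c) /\ mean (fun=> c) = c.
Proof.
move=> c0; have eT : [set w : T | xpredT w] = setT by apply/seteqP.
have mT : measurable [set w : T | xpredT w] by rewrite eT.
have [h1 h2] := nnint_bool mT.
by have := nnintZ c0 h1; rewrite h2 /prob eT probability_setT !mulr1.
Qed.

Lemma nnint_sum (I : Type) (s : seq I) (f : I -> T -> R) : (forall i, nnint (f i)) ->
  nnint (fun w => \sum_(i <- s) f i w) /\
  mean (fun w => \sum_(i <- s) f i w) = \sum_(i <- s) mean (f i).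
Proof.
move=> h; elim: s => [|i s [ih1 ih2]].
  have [h1 h2] := nnint_cst (lexx 0).
  by rewrite big_nil; under eq_fun do rewrite big_nil.
under eq_fun do rewrite big_cons; rewrite big_cons -ih2.
exact: nnintD.
Qed.

Lemma discrete_measurable_fun (C : Type) (A : T -> C) (f : C -> R) : discrete_rv A ->
  measurable_fun setT (fun w => f (A w)).
Proof. by move=> mA _ Y mY; rewrite setTI; apply: (mA (f @^-1` Y)). Qed.

Lemma integral_eq_law (C : countType) (A A' : T -> C) (f : C -> R) :
  discrete_rv A -> discrete_rv A' ->
  (forall c, prob (A @^-1` [set c]) = prob (A' @^-1` [set c])) ->
  (forall c, 0 <= f c) ->
  (\int[P]_w (f (A w))%:E = \int[P]_w (f (A' w))%:E)%E.
Proof.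
move=> mA mA' h f0.
(* [g] is [f] read on codes, with value 0 at numbers that encode nothing. The integral becomes a
   series over codes whose terms depend on the law alone. *)
pose g (m : nat) : R := oapp f 0 (@pickle_inv C m).
have g0 m : 0 <= g m by rewrite /g; case: (@pickle_inv C m) => //=.
have gE (B : T -> C) : discrete_rv B ->
    (\int[P]_w (f (B w))%:E =
     \sum_(m <oo) ((g m)%:E * (prob [set w | pickle (B w) == m])%:E))%E.
  move=> mB.
  have mm m : measurable [set w | pickle (B w) == m] by apply: (mB [set c | pickle c == m]).
  have mg m := nnintZ (g0 m) (nnint_bool (mm m)).1.
  transitivity (\int[P]_w (\sum_(m <oo) (g m * (pickle (B w) == m)%:R)%:E))%E.
    apply: eq_integral => w _.
    rewrite (@nneseriesD1 _ _ (pickle (B w))) //; last first.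
      by move=> m _; rewrite lee_fin mulr_ge0.
    rewrite eseries0 ?adde0.
      by rewrite eqxx mulr1 /g pickleK_inv.
    by move=> m _; rewrite andTb eq_sym => /negPf ->; rewrite mulr0.
  rewrite integral_nneseries //.
  - apply: eq_eseriesr => m _.
    by rewrite (meanE (mg m).1) (mg m).2 (nnint_bool (mm m)).2 EFinM.
  - by move=> m; apply/measurable_EFinP; have [[]] := mg m.
  - by move=> m w _; rewrite lee_fin mulr_ge0.
rewrite !gE //; apply: eq_eseriesr => m _; congr (_ * _%:E)%E.
exact: (prob_eq_law mA mA' h [set c | pickle c == m]).
Qed.

Lemma integral_tail (f : T -> nat) : discrete_rv f ->
  (\int[P]_w ((f w)%:R)%:E = \sum_(l <oo) (prob [set w | (l < f w)%N])%:E)%E.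
Proof.
move=> mf.
have mb l : measurable [set w | (l < f w)%N] by apply: (mf [set m | (l < m)%N]).
transitivity (\int[P]_w (\sum_(l <oo) ((l < f w)%N%:R : R)%:E))%E.
  apply: eq_integral => w _.
  rewrite (@nneseries_split _ _ 0 (f w)) // add0n.
  rewrite eseries0 ?adde0.
    rewrite big_mkord (eq_bigr (fun=> 1%:E)); last by move=> i _; rewrite ltn_ord.
    by rewrite sumEFin sumr_const card_ord.
  by move=> i hi _; rewrite ltnNge hi.
rewrite integral_nneseries //.
- apply: eq_eseriesr => l _.
  by have [h1 h2] := nnint_bool (mb l); rewrite (meanE h1) h2.
- by move=> l; apply/measurable_EFinP; have [[]] := nnint_bool (mb l).
Qed.

End DiscreteLaws.

(** * A covering lemma on the line *)

Section Covering.
Context (R : realDomainType).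
Implicit Type z : nat -> R.

(** The event that the one-sided maximal function of [z] at [i], over windows of length at most [n],
    exceeds [lam]. *)
Definition heavy z (lam : R) (n i : nat) : bool :=
  [exists l : 'I_n, lam * l.+1%:R < \sum_(i <= k < i + l.+1) z k].

(* Vitali covering on the line: the greedy choice of disjoint heavy windows
   covers every heavy starting point. *)
Lemma heavy_count_le z lam n M a : 0 <= lam -> (forall k, 0 <= z k) ->
  lam * (\sum_(a <= i < a + M) heavy z lam n i)%:R <= \sum_(a <= k < a + (M + n)) z k.
Proof.
(* Strong induction on the number of starting points, because a chosen window removes all those it
   covers at once. *)
move=> lam0 z0; have [m] := ubnP M; elim: m M a => // m IH M a hM.
have sum_le b c c' : (c <= c')%N -> \sum_(b <= k < c) z k <= \sum_(b <= k < c') z k.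
  move=> cc'; have [bc|cb] := leqP b c.
    by rewrite [leRHS](big_cat_nat bc cc') /= lerDl sumr_ge0.
  by rewrite big_geq ?sumr_ge0 // ltnW.
case: M hM => [|M] hM.
  by rewrite addn0 big_geq // mulr0 sumr_ge0.
have [/existsP[l hl]|hn] := boolP (heavy z lam n a); last first.
  rewrite big_ltn; last by rewrite addnS ltnS leq_addr.
  rewrite (negPf hn) add0n addnS -addSn.
  apply: le_trans (IH M a.+1 _) _ => //.
  rewrite [leRHS]big_ltn; last by rewrite addSn addnS ltnS leq_addr.
  by rewrite addSn addnS -addSn lerDr.
have cnt_le b c : (\sum_(b <= i < c) heavy z lam n i <= c - b)%N.
  rewrite -[X in (_ <= X)%N]muln1 -sum_nat_const_nat; apply: leq_sum => i _.
  exact: leq_b1.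
have [lM|Ml] := leqP l.+1 M.+1.
  rewrite [X in lam * X%:R](@big_cat_nat _ _ _ (a + l.+1)) /=; last 2 first.
  - by rewrite leq_addr.
  - by rewrite leq_add2l.
  rewrite [leRHS](@big_cat_nat _ _ _ (a + l.+1)) /=; last 2 first.
  - by rewrite leq_addr.
  - by rewrite leq_add2l (leq_trans lM) // leq_addr.
  rewrite natrD mulrDr lerD //.
    apply: le_trans (ltW hl); rewrite ler_wpM2l // ler_nat.
    by apply: leq_trans (cnt_le _ _) _; rewrite addKn.
  have -> : (a + M.+1 = (a + l.+1) + (M.+1 - l.+1))%N by move: lM; lia.
  have -> : (a + (M.+1 + n) = (a + l.+1) + ((M.+1 - l.+1) + n))%N by move: lM; lia.
  by apply: IH; rewrite subSS (leq_ltn_trans (leq_subr _ _)).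
(* The window reaches past the last starting point, so it alone pays for all that remain; the extra
   [n] terms on the right make room for its overhang. *)
apply: (@le_trans _ _ (lam * l.+1%:R)).
  rewrite ler_wpM2l // ler_nat; apply: leq_trans (cnt_le _ _) _.
  by rewrite addKn ltnW.
apply: le_trans (ltW hl) _; apply: sum_le.
by rewrite leq_add2l (leq_trans (ltn_ord l)) // leq_addl.
Qed.

End Covering.

(** * Scalar estimates for the front process *)

Section ScalarInequalities.
Variable R : realType.
Implicit Types (x y q s c u : R).

(** Both sides are x times a sum of N products, compared termwise: x + s <= ((1 + s) / 2) (1 + x),
    since the difference is (1 - s) (1 - x) / 2, and s <= (1 + s) / 2. *)
Lemma expr_diff_le x y s (N : nat) : 0 <= x -> x <= 1 -> 0 <= s -> s <= 1 ->
  (x + s) ^+ N - s ^+ N <= ((1 + s) / 2) ^+ N.-1 * ((1 + x) ^+ N - 1).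
Proof.
move=> x0 x1 s0 s1; case: N => [|N]; first by rewrite !expr0 !subrr mulr0.
rewrite -[X in _ * (_ - X)](expr1n _ N.+1) !subrXX addrK addrAC subrr add0r /=.
rewrite mulrCA ler_wpM2l // mulr_sumr; apply: ler_sum => i _.
rewrite expr1n mulr1 /=.
have iN : (i <= N)%N by rewrite -ltnS.
rewrite -[X in _ <= _ ^+ X * _](subnK iN) exprD mulrAC -exprMn.
have b0 : 0 <= (1 + s) / 2 by lra.
apply: ler_pM; rewrite ?exprn_ge0 ?addr_ge0 //.
  by rewrite lerXn2r ?nnegrE //; nra.
by rewrite lerXn2r ?nnegrE //; lra.
Qed.

(** In the application x is q to the size of the front and c its value at the full front. Both
    differences of powers contain x - c, and the remaining factor 1 - c is compensated by N factors
    [t] gained in each term. *)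
Lemma binom_sub_mono (c q : R) (N : nat) : 0 < q -> q < 1 -> 0 <= c -> c <= q ->
  1 <= N%:R * (1 / q - 1) * (1 - q) ->
  forall x, c <= x -> x <= q -> 0 < c ->
  (c + (1 - c) * c) ^+ N.+1 - c ^+ N.+1 <= (c + (1 - c) * x) ^+ N.+1 - x ^+ N.+1.
Proof.
move=> q0 q1 c0' cq hN x cx xq c0.
suff : x ^+ N.+1 - c ^+ N.+1 <= (c + (1 - c) * x) ^+ N.+1 - (c + (1 - c) * c) ^+ N.+1 by lra.
rewrite !subrXX.
rewrite (_ : c + (1 - c) * x - (c + (1 - c) * c) = (x - c) * (1 - c)); last by ring.
rewrite -mulrA ler_wpM2l ?subr_ge0 // mulr_sumr; apply: ler_sum => i _.
(* The largest factor with t y <= c + (1 - c) y for all y <= q. Bernoulli's inequality and the lower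
   bound on N then give (1 - c) t^N >= 1. *)
set t := 1 + (1 / q - 1) * c.
have iq : 1 / q * q = 1 by rewrite divfK // gt_eqF.
have q1' : 1 < 1 / q by rewrite ltr_pdivlMr // mul1r.
have t0 : 0 <= t by rewrite /t; nra.
have key y : c <= y -> y <= q -> t * y <= c + (1 - c) * y.
  move=> cy yq; rewrite /t.
  have : 1 / q * y <= 1 by rewrite mul1r mulrC ler_pdivrMr // mul1r.
  nra.
have iN : (i <= N)%N by rewrite -ltnS.
have ht : 1 <= (1 - c) * t ^+ N.
  have bern : 1 + N%:R * ((1 / q - 1) * c) <= t ^+ N.
    rewrite /t; elim: (N) => [|m ih]; first by rewrite mul0r addr0 expr0.
    have h0 : 0 <= (1/q - 1) * c by nra.
    rewrite exprS -natr1; apply: le_trans (ler_wpM2l t0 ih); rewrite /t.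
    set h := _ * c in h0 *.
    have : 0 <= m%:R * (h * h) by apply: mulr_ge0 => //; apply: mulr_ge0.
    by nra.
  apply: (@le_trans _ _ ((1 - c) * (1 + N%:R * ((1 / q - 1) * c)))).
    have : 1 <= N%:R * (1 / q - 1) * (1 - c).
      apply: le_trans hN _; rewrite ler_wpM2l //; last by lra.
      by rewrite mulr_ge0 // ?ler0n //; lra.
    nra.
  by rewrite ler_wpM2l //; lra.
have x0 : 0 <= x by lra.
apply: (@le_trans _ _ ((1 - c) * t ^+ N * (x ^+ (N.+1.-1 - i) * c ^+ i))).
  by rewrite ler_peMl // mulr_ge0 // exprn_ge0.
rewrite -mulrA ler_wpM2l //; first by lra.
rewrite /= -[X in t ^+ X](subnK iN) exprD mulrACA -!exprMn.
have cpos y : c <= y -> 0 <= c + (1 - c) * y by move=> ?; nra.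
apply: ler_pM; rewrite ?exprn_ge0 ?mulr_ge0 //.
  by rewrite lerXn2r ?nnegrE ?mulr_ge0 ?cpos // key.
by rewrite lerXn2r ?nnegrE ?mulr_ge0 ?cpos // key.
Qed.

Lemma one_plus_pow_le (N : nat) y : 0 <= y -> N%:R * y <= 1 / 2 ->
  (1 + y) ^+ N - 1 <= 2 * (N%:R * y).
Proof.
move=> y0 hN.
suff : forall m : nat, (m <= N)%N -> (1 + y) ^+ m <= 1 + 2 * (m%:R * y).
  by move=> /(_ N (leqnn _)); lra.
elim=> [|m ih] hm; first by rewrite expr0 mul0r mulr0 addr0.
have {}ih := ih (ltnW hm).
rewrite exprS -natr1.
have h0 : 0 <= m%:R * y by apply: mulr_ge0.
have h1 : m%:R * y <= 1 / 2 by apply: le_trans hN; rewrite ler_wpM2r // ler_nat ltnW.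
apply: (@le_trans _ _ ((1 + y) * (1 + 2 * (m%:R * y)))); first by rewrite ler_wpM2l //; lra.
nra.
Qed.

(** If N q^i <= 1 / 2, the linear term suffices. Otherwise 2 N q^i > 1, so its D-th power may be
    multiplied onto the trivial bound (1 + q)^N. The free exponent D makes this second term decay in
    i as fast as desired. *)
Lemma geometric_excess_le (N D i : nat) q : 0 < q -> q < 1 -> (0 < i)%N -> (0 < D)%N ->
  (1 + q ^+ i) ^+ N - 1 <=
    2 * N%:R * q ^+ i + (1 + q) ^+ N * (2 * N%:R * q ^+ i) ^+ D.
Proof.
move=> q0 q1 i0 D0.
have qi0 : 0 <= q ^+ i by rewrite exprn_ge0 // ltW.
have qi1 : q ^+ i <= q.
  by case: i i0 {qi0} => // i _; rewrite exprS ger_pMr // exprn_ile1 // ltW.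
have Nq0 : 0 <= N%:R * q ^+ i by rewrite mulr_ge0.
have [h|h] := leP (N%:R * q ^+ i) (1 / 2).
  apply: (le_trans (one_plus_pow_le qi0 h)); rewrite mulrA lerDl mulr_ge0 //.
    by rewrite exprn_ge0 //; lra.
  by rewrite exprn_ge0 // -mulrA mulr_ge0.
apply: (@le_trans _ _ ((1 + q) ^+ N)).
  apply: (@le_trans _ _ ((1 + q ^+ i) ^+ N)); first by lra.
  by rewrite lerXn2r ?nnegrE //; lra.
rewrite -[leLHS]addr0 addrC lerD //.
  by rewrite -mulrA mulr_ge0.
rewrite ler_peMr //; first by rewrite exprn_ge0 //; lra.
by rewrite exprn_ege1 // -mulrA; lra.
Qed.

(** The two terms of [geometric_excess_le] are geometric in N - b, with ratios s = q and s = q^D.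
    Summed against the binomial weights, each is at most (x + s)^N - s^N, and [expr_diff_le] gains a
    power of (1 + s) / 2. *)
Lemma excess_kernel_le (N D : nat) q x : 0 < q -> q < 1 -> (0 < D)%N -> 0 <= x -> x <= 1 ->
  \sum_(1 <= b < N) 'C(N, b)%:R * x ^+ b * ((1 + q ^+ (N - b)) ^+ N - 1) <=
  (2 * N%:R * ((1 + q) / 2) ^+ N.-1 +
   (1 + q) ^+ N * (2 * N%:R) ^+ D * ((1 + q ^+ D) / 2) ^+ N.-1) * ((1 + x) ^+ N - 1).
Proof.
move=> q0 q1 D0 x0 x1.
have q0' := ltW q0.
have binE s : (0 < N)%N -> 0 <= s -> \sum_(1 <= b < N) 'C(N, b)%:R * x ^+ b * s ^+ (N - b) <=
    (x + s) ^+ N - s ^+ N.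
  move=> N0 s0; rewrite [x + s]addrC exprDn -(big_mkord xpredT (fun i => s ^+ (N - i) * x ^+ i *+ 'C(N, i))).
  rewrite big_ltn // bin0 mulr1n subn0 expr0 mulr1 addrAC subrr add0r.
  rewrite big_nat_recr //= -[leLHS]addr0 lerD //.
    by apply: ler_sum => i _; rewrite -[X in _ <= X]mulr_natl [X in _ <= _ * X]mulrC mulrA.
  by rewrite mulrn_wge0 // mulr_ge0 // exprn_ge0.
case: (posnP N) => [->|N0].
  by rewrite big_geq // !expr0 subrr mulr0.
apply: (@le_trans _ _ (2 * N%:R * (\sum_(1 <= b < N) 'C(N, b)%:R * x ^+ b * q ^+ (N - b)) +
   (1 + q) ^+ N * (2 * N%:R) ^+ D * (\sum_(1 <= b < N) 'C(N, b)%:R * x ^+ b * (q ^+ D) ^+ (N - b)))).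
  rewrite !mulr_sumr -big_split /= !big_nat; apply: ler_sum => b /andP[b1 bN].
  have cx : 0 <= 'C(N, b)%:R * x ^+ b by rewrite mulr_ge0 // exprn_ge0.
  apply: le_trans (ler_wpM2l cx (@geometric_excess_le N D (N - b) q q0 q1 _ D0)) _.
    by rewrite subn_gt0.
  rewrite [(2 * N%:R * q ^+ (N - b)) ^+ D]exprMn -exprM mulnC exprM.
  rewrite le_eqVlt; apply/orP; left; apply/eqP.
  move: ('C(N, b)%:R) (x ^+ b) (q ^+ (N - b)) ((q ^+ D) ^+ (N - b)) ((1 + q) ^+ N) ((2 * N%:R) ^+ D).
  by move=> *; ring.
rewrite [leRHS]mulrDl; apply: lerD.
  rewrite -!mulrA ler_wpM2l // ler_wpM2l //.
  apply: (le_trans (binE q N0 q0')); apply: expr_diff_le => //; exact: ltW.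
have qD0 : 0 <= q ^+ D by rewrite exprn_ge0.
have qD1 : q ^+ D <= 1 by rewrite exprn_ile1 // ltW.
have h1 : 0 <= (1 + q) ^+ N by rewrite exprn_ge0 //; lra.
have h2 : 0 <= (2 * N%:R : R) ^+ D by rewrite exprn_ge0 // mulr_ge0.
rewrite -[leRHS]mulrA ler_wpM2l ?mulr_ge0 //.
by apply: (le_trans (binE _ N0 qD0)); apply: expr_diff_le.
Qed.

End ScalarInequalities.

(** * A supersolution of the linear system *)

Section Supersolution.
Variables (R : realType) (q : R) (N : nat) (eps : R).
Hypotheses (q0 : 0 < q) (q1 : q < 1) (N0 : (0 < N)%N) (eps0 : 0 <= eps) (eps1 : eps < 1).
Hypothesis excess : forall x, 0 <= x <= 1 ->
  \sum_(1 <= b < N) 'C(N, b)%:R * x ^+ b * ((1 + q ^+ (N - b)) ^+ N - 1) <= eps * ((1 + x) ^+ N - 1).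

Let w b := 1 + (1 - eps)^-1 * ((1 + q ^+ (N - b)) ^+ N - 1).

(** The system divided by q^(a N), the leading 1 being the term b = 0. The main parts of [w] sum to
    at most (1 + x)^N, the excess parts to C eps ((1 + x)^N - 1); closing the estimate requires 1 +
    C eps = C, whence C = (1 - eps)^-1. *)
Let w_sum a : 1 + \sum_(1 <= b < N) 'C(N, b)%:R * (q ^+ (N - a)) ^+ b * w b <= w a.
Proof.
set x := q ^+ (N - a).
have x01 : 0 <= x <= 1 by rewrite exprn_ge0 ?exprn_ile1 ?ltW.
have /andP[x0 x1] := x01.
have ie : 0 <= (1 - eps)^-1 by rewrite invr_ge0 subr_ge0 ltW.
apply: (@le_trans _ _ ((1 + x) ^+ N + (1 - eps)^-1 * (eps * ((1 + x) ^+ N - 1)))); last first.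
  rewrite /w -/x; set y := (_ ^+ N).
  have : (1 - eps)^-1 * (1 - eps) = 1 by rewrite mulVf // gt_eqF // subr_gt0.
  move: ((1 - eps)^-1) => i hi.
  have -> : y + i * (eps * (y - 1)) = 1 + (y - 1) * (i * (1 - eps) + i * eps) by rewrite hi; ring.
  by rewrite le_eqVlt; apply/orP; left; apply/eqP; ring.
rewrite /w; under eq_bigr => b _ do rewrite mulrDr mulr1 mulrCA.
rewrite big_split /= -mulr_sumr addrA; apply: lerD; last by rewrite ler_wpM2l // excess.
rewrite exprDn -(big_mkord xpredT (fun i => 1 ^+ (N - i) * x ^+ i *+ 'C(N, i))).
rewrite [leRHS]big_ltn // expr1n expr0 mulr1 bin0 mulr1n lerD2l.
rewrite [leRHS]big_nat_recr //= -[leLHS]addr0 lerD //.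
  by apply: ler_sum => b _; rewrite expr1n mul1r mulr_natl.
by rewrite mulrn_wge0 // expr1n mul1r exprn_ge0.
Qed.

(* If each of the N vertices missed the front with probability q^N, then
   q^(a |front|) would have mean close to q^(a N) (1 + q^(N - a))^N; the factor
   (1 - eps)^-1 absorbs the fronts produced by a previously depleted front. *)
Lemma gf_supersolution (z : nat -> nat -> R) :
  (forall t, z t 0%N = 1) ->
  (forall a, z 0%N a = q ^+ (a * N)) ->
  (forall t a, z t.+1 a <=
     \sum_(0 <= b < N) 'C(N, b)%:R * (1 - q ^+ a) ^+ b * q ^+ (a * (N - b)) * z t b) ->
  forall t a, (0 < a <= N)%N ->
    z t a <= q ^+ (a * N) * (1 + (1 - eps)^-1 * ((1 + q ^+ (N - a)) ^+ N - 1)).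
Proof.
move=> z0 zinit zrec.
have q0' := ltW q0.
have qle1 j : q ^+ j <= 1 by rewrite exprn_ile1 // ltW.
have qge0 j : 0 <= q ^+ j by rewrite exprn_ge0.
have w1 b : 1 <= w b.
  rewrite /w lerDl mulr_ge0 //; first by rewrite invr_ge0 subr_ge0 ltW.
  by rewrite subr_ge0; apply: exprn_ege1; rewrite lerDl; apply: qge0.
elim=> [|t IH] a aN; first by rewrite zinit -/(w a) ler_peMr.
have /andP[a0 aN'] := aN.
apply: le_trans (zrec t a) _; rewrite big_ltn // bin0 expr0 !mul1r subn0 z0 mulr1.
rewrite -/(w a); apply: le_trans (ler_wpM2l (qge0 (a * N)%N) (w_sum a)).
rewrite mulrDr mulr1 lerD2l mulr_sumr !big_nat; apply: ler_sum => b /andP[b1 bN].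
have k0 : 0 <= 'C(N, b)%:R * (1 - q ^+ a) ^+ b * q ^+ (a * (N - b)).
  by rewrite !mulr_ge0 ?exprn_ge0 ?subr_ge0.
have hb : z t b <= q ^+ (b * N) * w b by apply: IH; rewrite b1 ltnW.
apply: le_trans (ler_wpM2l k0 hb) _.
(* a (N - b) + b N = a N + b (N - a): the kernel times the bound for [z t b] contains the common
   power q^(a N). The factor (1 - q^a)^b is finally bounded by 1. *)
have e : q ^+ (a * (N - b)) * q ^+ (b * N) = q ^+ (a * N) * (q ^+ (N - a)) ^+ b.
  by rewrite -!exprM -!exprD; congr (_ ^+ _); move: bN aN'; nia.
have -> : 'C(N, b)%:R * (1 - q ^+ a) ^+ b * q ^+ (a * (N - b)) * (q ^+ (b * N) * w b) =
   (1 - q ^+ a) ^+ b * ('C(N, b)%:R * (q ^+ (a * (N - b)) * q ^+ (b * N)) * w b) by ring.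
rewrite e.
have -> : q ^+ (a * N) * ('C(N, b)%:R * (q ^+ (N - a)) ^+ b * w b) =
   'C(N, b)%:R * (q ^+ (a * N) * (q ^+ (N - a)) ^+ b) * w b by ring.
rewrite ler_piMl //.
  by rewrite !mulr_ge0 ?exprn_ge0 // (le_trans ler01).
by rewrite exprn_ile1 ?subr_ge0 // lerBlDr lerDl.
Qed.

End Supersolution.

(** * Passage times in an i.i.d. environment *)

Section Noise.
Context (d : measure_display) (T : measurableType d) (R : realType) (P : probability T R).
Variable n : nat.
Local Notation E := {ffun 'I_n.+1 * 'I_n.+1 -> nat}.
Variables (H : nat -> T -> E) (nu : E -> R) (r : nat -> R) (mu : R).
Hypothesis H_rv : forall t, discrete_rv (H t).
(** Joint point masses at distinct times express both the independence of the noise matrices and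
    their common law [nu]. [H_tail] adds independence of the entries of one matrix, with [r l] the
    probability that an entry is at least l, and [r_sum] bounds the mean of an entry by [mu]. *)
Hypothesis H_law : forall l : seq (nat * E), uniq (unzip1 l) ->
  prob P [set w | all (fun te => H te.1 w == te.2) l] = \prod_(te <- l) nu te.2.
Hypothesis H_tail : forall t (A : {set 'I_n.+1 * 'I_n.+1}) l,
  prob P [set w | [forall p in A, (l <= H t w p)%N]] = r l ^+ #|A|.
Hypothesis r_sum : forall m, \sum_(0 <= l < m) r l.+1 <= mu.

Definition seg a m w : seq E := [seq H s w | s <- iota a m].

Lemma size_seg a m w : size (seg a m w) = m.
Proof. by rewrite size_map size_iota. Qed.

Lemma seg_cat a m m' w : seg a (m + m') w = seg a m w ++ seg (a + m) m' w.
Proof. by rewrite /seg iotaD map_cat. Qed.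

Lemma seg_rv a m : discrete_rv (seg a m).
Proof.
elim: m a => [|m IH] a X.
  have [h|h] := pselect (X [::]).
    have -> : seg a 0 @^-1` X = setT by apply/seteqP; split.
    exact: measurableT.
  have -> : seg a 0 @^-1` X = set0 by apply/seteqP; split.
  exact: measurable0.
exact: (discrete_rv_pair (H_rv a) (IH a.+1) [set eh | X (eh.1 :: eh.2)]).
Qed.

Lemma seg_zip a m h w : size h = m ->
  (seg a m w = h) <-> all (fun te => H te.1 w == te.2) (zip (iota a m) h).
Proof.
elim: m a h => [|m IH] a [|e h] //= [sh].
have {}IH := IH a.+1 h sh; rewrite /seg /=; split.
  by move=> [h1 /IH h2]; rewrite h1 eqxx h2.
by move=> /andP[/eqP <- /IH <-].
Qed.

Lemma seg_law a m h : prob P (seg a m @^-1` [set h]) =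
  if size h == m then \prod_(e <- h) nu e else 0.
Proof.
case: eqP => [sh|sh]; last first.
  rewrite (_ : _ @^-1` _ = set0); first by rewrite /prob measure0.
  by apply/seteqP; split => w //= hw; apply: sh; rewrite -hw size_seg.
rewrite (_ : _ @^-1` _ = [set w | all (fun te => H te.1 w == te.2) (zip (iota a m) h)]).
  rewrite H_law ?unzip1_zip ?size_iota ?sh // ?iota_uniq //.
  have {2}-> : h = unzip2 (zip (iota a m) h) by rewrite unzip2_zip // size_iota sh.
  by rewrite big_map.
by apply/seteqP; split => w /= /(seg_zip a w sh).
Qed.

Lemma seg_indep a m b m' h h' : (a + m <= b)%N ->
  prob P (seg a m @^-1` [set h] `&` seg b m' @^-1` [set h']) =
  prob P (seg a m @^-1` [set h]) * prob P (seg b m' @^-1` [set h']).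
Proof.
move=> ab; rewrite !seg_law; case: eqP => [sh|sh]; last first.
  rewrite mul0r (_ : _ `&` _ = set0); first by rewrite /prob measure0.
  by apply/seteqP; split => w //= [hw _]; apply: sh; rewrite -hw size_seg.
case: eqP => [sh'|sh']; last first.
  rewrite mulr0 (_ : _ `&` _ = set0); first by rewrite /prob measure0.
  by apply/seteqP; split => w //= [_ hw]; apply: sh'; rewrite -hw size_seg.
rewrite (_ : _ `&` _ = [set w | all (fun te => H te.1 w == te.2)
   (zip (iota a m ++ iota b m') (h ++ h'))]).
  rewrite H_law ?unzip1_zip ?size_cat ?size_iota ?sh ?sh' //.
    rewrite -big_cat /=.
    have {2}-> : h ++ h' = unzip2 (zip (iota a m ++ iota b m') (h ++ h')).
      by rewrite unzip2_zip // !size_cat !size_iota sh sh'.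
    by rewrite big_map.
  rewrite cat_uniq !iota_uniq andbT /=; apply/hasPn => i.
  by rewrite !mem_iota; lia.
apply/seteqP; split => w; rewrite /= zip_cat ?size_iota ?sh // all_cat.
  by move=> [/(seg_zip a w sh) -> /(seg_zip b w sh') ->].
by move=> /andP[/(seg_zip a w sh) -> /(seg_zip b w sh') ->].
Qed.

Lemma seg_stationary a b m : forall X,
  prob P (seg a m @^-1` X) = prob P (seg b m @^-1` X).
Proof.
apply: prob_eq_law; [exact: seg_rv|exact: seg_rv|].
by move=> h; rewrite !seg_law.
Qed.

Lemma mean_stationary a b m (f : seq E -> R) : (forall h, 0 <= f h) ->
  mean P (fun w => f (seg a m w)) = mean P (fun w => f (seg b m w)).
Proof.
move=> f0; rewrite /mean (@integral_eq_law _ _ _ P _ (seg a m) (seg b m)) //.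
- exact: seg_rv.
- exact: seg_rv.
- by move=> h; rewrite !seg_law.
Qed.

Lemma nnint_stationary a b m (f : seq E -> R) : (forall h, 0 <= f h) ->
  nnint P (fun w => f (seg a m w)) -> nnint P (fun w => f (seg b m w)).
Proof.
move=> f0 [h1 h2 h3]; split => //.
  exact: (discrete_measurable_fun _ (seg_rv b m)).
rewrite (@integral_eq_law _ _ _ P _ (seg b m) (seg a m)) //.
- exact: seg_rv.
- exact: seg_rv.
- by move=> h; rewrite !seg_law.
Qed.

Definition load t w : R := (entry_sum (H t w))%:R.
Definition travel a m w : R := (passage (seg a m w))%:R.

Lemma r_ge0 l : 0 <= r l.
Proof.
have := H_tail 0 (finset.set1 (ord0, ord0)) l.
by rewrite finset.cards1 expr1 => <-; apply: prob_ge0.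
Qed.

Lemma nnint_load t : nnint P (load t).
Proof.
have ent p : nnint P (fun w => (H t w p)%:R : R).
  have mp : discrete_rv (fun w => H t w p) by apply: (discrete_rv_comp (fun e : E => e p) (H_rv t)).
  split => //; first exact: (discrete_measurable_fun (fun k => k%:R) mp).
  rewrite (integral_tail P mp) (@le_lt_trans _ _ mu%:E) ?ltry //.
  apply: lime_le.
    by apply: is_cvg_nneseries => l _ _; rewrite lee_fin prob_ge0.
  apply: nearW => m; rewrite sumEFin lee_fin; apply: le_trans (r_sum m).
  apply: ler_sum => l _.
  have := H_tail t (finset.set1 p) l.+1; rewrite finset.cards1 expr1 => <-.
  rewrite le_eqVlt; apply/orP; left; apply/eqP; congr prob.
  apply/seteqP; split => w /=.
    by move=> h; apply/forallP => x; apply/implyP; rewrite finset.in_set1 => /eqP ->.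
  by move=> /forallP /(_ p); rewrite finset.in_set1 eqxx.
have [] := nnint_sum (index_enum _) ent.
rewrite (_ : (fun w => \sum_(i <- index_enum _) (H t w i)%:R) = load t) //.
by apply/funext => w; rewrite /load /entry_sum natr_sum.
Qed.

Definition load_mean := mean P (load 0).

Lemma load_meanE t : mean P (load t) = load_mean.
Proof.
exact: (@mean_stationary t 0 1 (fun h : seq E => (entry_sum (head [ffun=> 0%N] h))%:R)).
Qed.

Lemma travel_rv a m : discrete_rv (fun w => passage (seg a m w)).
Proof. exact: (discrete_rv_comp _ (seg_rv a m)). Qed.

Lemma travel_measurable a m : measurable_fun setT (travel a m).
Proof. exact: (discrete_measurable_fun (fun k => k%:R) (travel_rv a m)). Qed.

Lemma nnint_travel a m : nnint P (travel a m).
Proof.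
have [h1 _] := nnint_sum (iota a m) nnint_load.
have [] // := nnint_le h1 (travel_measurable a m).
move=> w; rewrite ler0n /=; elim: m a {h1} => [|m IH] a.
  by rewrite big_nil /travel passage_nil.
rewrite big_cons; apply: le_trans (lerD (lexx _) (IH a.+1)).
by rewrite /load /travel -natrD ler_nat passage_cons.
Qed.

Definition travel_mean m := mean P (travel 0 m).

Lemma travel_meanE a m : mean P (travel a m) = travel_mean m.
Proof. by apply: (@mean_stationary a 0 m (fun h => (passage h)%:R)). Qed.

Lemma travel_mean_ge0 m : 0 <= travel_mean m.
Proof. exact: mean_ge0. Qed.

Lemma travel_superadd a m m' w : travel a m w + travel (a + m) m' w <= travel a (m + m') w.
Proof. by rewrite /travel -natrD ler_nat seg_cat passage_superadd. Qed.

Lemma travel_subadd a m m' w :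
  travel a (m + m') w <= travel a m w + (load (a + m) w + travel (a + m) m' w).
Proof.
case: m' => [|m']; first by rewrite addn0 lerDl addr_ge0.
rewrite /travel /load -!natrD ler_nat seg_cat [in X in (_ <= X)%N]/seg /=.
by rewrite addnA; apply: passage_subadd.
Qed.

Lemma travel_mean_superadd m m' : travel_mean m + travel_mean m' <= travel_mean (m + m').
Proof.
rewrite -(travel_meanE m m').
have [h <-] := nnintD (nnint_travel 0 m) (nnint_travel m m').
have [_ mh _] := h; have [] // := nnint_le (nnint_travel 0 (m + m')) mh.
by move=> w; rewrite addr_ge0 //= travel_superadd.
Qed.

Lemma travel_mean_subadd m m' : travel_mean (m + m') <= travel_mean m + (load_mean + travel_mean m').
Proof.
rewrite -(travel_meanE m m') -(load_meanE m).
have [h2 <-] := nnintD (nnint_load m) (nnint_travel m m').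
have [h <-] := nnintD (nnint_travel 0 m) h2.
have [] // := nnint_le h (travel_measurable 0 (m + m')).
by move=> w; rewrite ler0n /= travel_subadd.
Qed.

(** Both sides bound the mean passage time over l m steps, cut into l blocks of length m by
    superadditivity and into m blocks of length l by subadditivity. *)
Lemma travel_mean_fekete m l : (0 < m)%N -> (0 < l)%N ->
  l%:R * travel_mean m <= m%:R * (travel_mean l + load_mean).
Proof.
move=> m0 l0.
have super k s : k%:R * travel_mean s <= travel_mean (k * s).
  elim: k => [|k IH]; first by rewrite mul0r travel_mean_ge0.
  rewrite -natr1 mulrDl mul1r addrC mulSn.
  by apply: le_trans (travel_mean_superadd _ _); rewrite lerD2l.
have sub k s : travel_mean (k * s) <= k%:R * (travel_mean s + load_mean).
  elim: k => [|k IH].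
    rewrite mul0r mul0n /travel_mean /travel /seg /=.
    under eq_fun do rewrite passage_nil.
    by have [_ ->] := @nnint_cst _ _ _ P 0 (lexx 0).
  rewrite -natr1 mulrDl mul1r addrC mulSn -addrA.
  apply: le_trans (travel_mean_subadd _ _) _; rewrite lerD2l.
  by rewrite lerD2l.
by apply: le_trans (super _ _) _; rewrite mulnC; apply: sub.
Qed.

(** g is the supremum of the ratios [travel_mean m / m]; by [travel_mean_fekete] every
    ([travel_mean l] + [load_mean]) / l is an upper bound of them. *)
Lemma speed_exists : exists g : R, forall l, (0 < l)%N ->
  travel_mean l <= g * l%:R <= travel_mean l + load_mean.
Proof.
pose S := [set x | exists2 m, (0 < m)%N & x = travel_mean m / m%:R].
have ubS l : (0 < l)%N -> ubound S ((travel_mean l + load_mean) / l%:R).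
  move=> l0 _ [m m0 ->]; rewrite ler_pdivrMr ?ltr0n // mulrAC ler_pdivlMr ?ltr0n //.
  by rewrite mulrC [leRHS]mulrC travel_mean_fekete.
have S0 : S !=set0 by exists (travel_mean 1 / 1%:R); exists 1%N.
exists (sup S) => l l0; apply/andP; split.
  rewrite -ler_pdivrMr ?ltr0n //; apply: ub_le_sup; last by exists l.
  by exists ((travel_mean 1 + load_mean) / 1%:R); apply: ubS.
by rewrite -ler_pdivlMr ?ltr0n //; apply: ge_sup => //; apply: ubS.
Qed.

(** * Frequencies of block events *)

Section BlockFrequencies.
Variables (L : nat) (X : pred (seq E)).
Let p := prob P (seg 0 L @^-1` [set h | X h]).
Let cnt (m : nat) w : R := \sum_(0 <= k < m) (X (seg (k * L) L w))%:R.

Let mX k : measurable [set w | X (seg (k * L) L w)].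
Proof. exact: (seg_rv (k * L) L [set h | X h]). Qed.

Let pE k : prob P [set w | X (seg (k * L) L w)] = p.
Proof. exact: (seg_stationary (k * L) 0 L [set h | X h]). Qed.

Let p01 : 0 <= p <= 1.
Proof. by rewrite prob_ge0 prob_le1 //; exact: (seg_rv 0 L [set h | X h]). Qed.

Let pair_mean j k : nnint P (fun w => (X (seg (j * L) L w) && X (seg (k * L) L w))%:R) /\
  mean P (fun w => (X (seg (j * L) L w) && X (seg (k * L) L w))%:R) = if j == k then p else p ^+ 2.
Proof.
have mI : measurable [set w | X (seg (j * L) L w) && X (seg (k * L) L w)].
  rewrite (_ : [set w | _] = [set w | X (seg (j * L) L w)] `&` [set w | X (seg (k * L) L w)]).
    exact: measurableI.
  by apply/seteqP; split => w /= /andP.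
have [h1 h2] := nnint_bool P mI; split => //; rewrite {}h2.
have ind i i' : (i < i')%N ->
    prob P [set w | X (seg (i * L) L w) && X (seg (i' * L) L w)] = p ^+ 2.
  move=> ii'.
  rewrite (_ : [set w | _] = seg (i * L) L @^-1` [set h | X h] `&` seg (i' * L) L @^-1` [set h | X h]).
    rewrite (prob_indep (seg_rv _ _) (seg_rv _ _)) ?pE ?expr2 // => h h'.
    by apply: seg_indep; rewrite addnC -mulSn leq_mul2r ii' orbT.
  by apply/seteqP; split => w /= /andP.
have [jk|kj|<-] := ltngtP j k; first exact: ind.
  rewrite -(ind _ _ kj); congr prob.
  by apply/seteqP; split => w /=; rewrite andbC.
rewrite -(pE j); congr prob.
by apply/seteqP; split => w /=; rewrite andbb.
Qed.

Let cnt_mean m : nnint P (cnt m) /\ mean P (cnt m) = m%:R * p.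
Proof.
have hb k : nnint P (fun w => (X (seg (k * L) L w))%:R) by have [] := nnint_bool P (mX k).
have [h1 h2] := nnint_sum (index_iota 0 m) hb.
split; first exact: h1.
rewrite /cnt h2 (eq_bigr (fun=> p)); last first.
  by move=> k _; have [_ ->] := nnint_bool P (mX k); rewrite pE.
by rewrite big_const_nat subn0 iter_addr_0 mulr_natl.
Qed.

Lemma block_frequency_L2 m : nnint P (fun w => (cnt m w - m%:R * p) ^+ 2) /\
  mean P (fun w => (cnt m w - m%:R * p) ^+ 2) <= m%:R.
Proof.
have [h1 e1] := cnt_mean m.
have /andP[p0 p1] := p01.
have mp0 : 0 <= m%:R * p by rewrite mulr_ge0.
have [hs es] := nnint_sum (index_iota 0 m) (fun j => (nnint_sum (index_iota 0 m) (fun k => (pair_mean j k).1)).1).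
have [hc ec] := nnint_cst P (exprn_ge0 2 mp0).
have [hl el] := nnintD hs hc.
have [hz ez] := nnintZ (mulr_ge0 (ler0n R 2) mp0) h1.
pose sq w := (cnt m w - m%:R * p) ^+ 2.
have msq : measurable_fun setT sq.
  apply: measurable_funX; apply: measurable_funB => //; by case: h1.
(* The square is expanded with the cross term moved to the left, so that every function to be
   integrated is nonnegative. *)
have idn w : (sq w + 2 * (m%:R * p) * cnt m w =
   \sum_(j <- index_iota 0 m) \sum_(k <- index_iota 0 m)
     (X (seg (j * L) L w) && X (seg (k * L) L w))%:R + (m%:R * p) ^+ 2).
  have -> : \sum_(j <- index_iota 0 m) \sum_(k <- index_iota 0 m)
     (X (seg (j * L) L w) && X (seg (k * L) L w))%:R = cnt m w * cnt m w.
    rewrite /cnt mulr_suml; apply: eq_bigr => j _; rewrite mulr_sumr.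
    by apply: eq_bigr => k _; rewrite -natrM mulnb.
  by rewrite /sq; ring.
have eF := funext idn; rewrite -eF in hl el.
have [hsq _] : nnint P sq /\ mean P sq <= mean P (fun w => sq w + 2 * (m%:R * p) * cnt m w).
  apply: (nnint_le hl msq) => w; rewrite sqr_ge0 /= lerDl.
  by case: hz => + _ _; apply.
split => //.
have [hD eD] := nnintD hsq hz.
have : mean P sq + 2 * (m%:R * p) * (m%:R * p) =
   \sum_(j <- index_iota 0 m) \sum_(k <- index_iota 0 m) (if j == k then p else p ^+ 2) + (m%:R * p) ^+ 2.
  rewrite -[X in _ + _ * X]e1 -ez -eD.
  rewrite el ec es; congr (_ + _); apply: eq_bigr => j _.
  have [_ ->] := nnint_sum (index_iota 0 m) (fun k => (pair_mean j k).1).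
  by apply: eq_bigr => k _; have [_ ->] := pair_mean j k.
have -> : \sum_(j <- index_iota 0 m) \sum_(k <- index_iota 0 m) (if j == k then p else p ^+ 2) =
    m%:R * (p - p ^+ 2) + (m%:R * p) ^+ 2.
  have row j : j \in index_iota 0 m ->
      \sum_(k <- index_iota 0 m) (if j == k then p else p ^+ 2) = (p - p ^+ 2) + m%:R * p ^+ 2.
    move=> jm; rewrite (eq_bigr (fun k => (if k == j then p - p ^+ 2 else 0) + p ^+ 2)); last first.
      by move=> k _; rewrite eq_sym; case: eqP => _; rewrite ?subrK ?add0r.
    rewrite big_split /= -big_mkcond /= big_const_nat subn0 iter_addr_0 mulr_natl.
    by rewrite -big_filter filter_pred1_uniq ?iota_uniq // big_seq1.
  rewrite (eq_big_seq _ row) big_const_nat subn0 iter_addr_0 -mulr_natl; ring.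
have : m%:R * (p - p ^+ 2) <= m%:R by rewrite ler_piMr //; nra.
nra.
Qed.

(** Integrates |x| <= y + x^2 / y at y = del m, a form of Cauchy-Schwarz with a free parameter. *)
Lemma block_frequency_L1 m del : 0 < del -> (0 < m)%N ->
  nnint P (fun w => `|cnt m w - m%:R * p|) /\
  mean P (fun w => `|cnt m w - m%:R * p|) <= del * m%:R + del^-1.
Proof.
move=> del0 m0; have [h e] := block_frequency_L2 m.
have [hc ec] := nnint_cst P (mulr_ge0 (ltW del0) (ler0n R m)).
have dm0 : 0 < del * m%:R by rewrite mulr_gt0 // ltr0n.
have iv0 : 0 <= (del * m%:R)^-1 by rewrite invr_ge0 ltW.
have [hz ez] := nnintZ iv0 h.
have [hD eD] := nnintD hc hz.
have [] : nnint P (fun w => `|cnt m w - m%:R * p|) /\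
    mean P (fun w => `|cnt m w - m%:R * p|) <=
    mean P (fun w => del * m%:R + (del * m%:R)^-1 * (cnt m w - m%:R * p) ^+ 2).
  apply: (nnint_le hD).
    apply: measurableT_comp => //; apply: measurable_funB => //.
    by have [[]] := cnt_mean m.
  move=> w; rewrite normr_ge0 /=; set x := _ - _.
  rewrite -(ler_pM2r dm0) mulrDl [X in _ <= _ + X]mulrAC mulVf ?gt_eqF // mul1r.
  rewrite -(real_normK (num_real x)); move: (normr_ge0 x) (ltW dm0).
  by move: `|x| (del * m%:R) => a y a0 y0; nra.
move=> h' /le_trans h''; split => //; apply: h''; rewrite eD ec ez lerD2l.
apply: (@le_trans _ _ ((del * m%:R)^-1 * m%:R)).
  by rewrite ler_wpM2l // invr_ge0 ltW.
by rewrite invfM divfK ?gt_eqF ?ltr0n.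
Qed.

End BlockFrequencies.

(** * The maximal inequality for functions of blocks *)

Section MaximalInequality.
Variables (L : nat) (f : seq E -> R) (lam : R).
Hypothesis f_ge0 : forall h, 0 <= f h.
Hypothesis f_int : nnint P (fun w => f (seg 0 L w)).
Hypothesis lam_gt0 : 0 < lam.
Let z w k := f (seg (k * L) L w).

(** Heaviness at i is a function of the m blocks from i on, the same function for every i; this
    gives its measurability and its stationarity. *)
Let heavy_seg m i w : heavy (z w) lam m i =
  heavy (fun k => f (take L (drop (k * L) (seg (i * L) (m * L) w)))) lam m 0.
Proof.
apply: eq_existsb => l; congr (_ < _).
have -> : \sum_(i <= k < i + l.+1) z w k = \sum_(0 <= k < l.+1) z w (k + i).
  by rewrite -{1}[i]add0n big_addn addKn.
rewrite add0n; apply: eq_big_nat => k /andP[_ kl].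
rewrite /z /seg -map_drop -map_take drop_iota take_iota -mulnDl addnC; congr (f (map _ (iota _ _))).
apply/esym/minn_idPl; rewrite -mulnBl -[X in (X <= _)%N]mul1n leq_mul2r; apply/orP; right.
by rewrite subn_gt0; apply: leq_trans kl _; rewrite ltn_ord.
Qed.

Lemma heavy_measurable m i : measurable [set w | heavy (z w) lam m i].
Proof.
under eq_fun do rewrite heavy_seg.
exact: (seg_rv (i * L) (m * L)
  [set h | heavy (fun k => f (take L (drop (k * L) h))) lam m 0]).
Qed.

Lemma heavy_prob_le m :
  lam * prob P [set w | heavy (z w) lam m 0] <= mean P (fun w => f (seg 0 L w)).
Proof.
set e := mean P _; set b := prob P _.
have heavyE i : prob P [set w | heavy (z w) lam m i] = b.
  rewrite /b; under [in LHS]eq_fun do rewrite heavy_seg.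
  under [in RHS]eq_fun do rewrite heavy_seg.
  exact: (seg_stationary (i * L) (0 * L) (m * L)
    [set h | heavy (fun k => f (take L (drop (k * L) h))) lam m 0]).
have zint k : nnint P (z^~ k) by apply: (@nnint_stationary 0).
have zmean k : mean P (z^~ k) = e by apply: (@mean_stationary _ 0).
(* The covering lemma averaged over the environment. Large M makes the m boundary blocks
   negligible. *)
have key M : lam * (M%:R * b) <= (M + m)%:R * e.
  have hb i : nnint P (fun w => (heavy (z w) lam m i)%:R).
    by have [] := nnint_bool P (heavy_measurable m i).
  have [h1 e1] := nnint_sum (index_iota 0 M) hb.
  have [h2 e2] := nnint_sum (index_iota 0 (M + m)) zint.
  have [h3 e3] := nnintZ (ltW lam_gt0) h1.
  have le w : 0 <= lam * \sum_(0 <= i < M) (heavy (z w) lam m i)%:R <=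
      \sum_(0 <= k < M + m) z w k.
    apply/andP; split; first by case: h3 => + _ _; apply.
    rewrite -natr_sum.
    exact: (@heavy_count_le _ (z w) lam m M 0 (ltW lam_gt0) (fun k => f_ge0 _)).
  have [_ m3 _] := h3; have [_] := nnint_le h2 m3 le.
  rewrite e3 e1 e2 (eq_bigr (fun=> b)); last first.
    move=> i _; have [_ ->] := nnint_bool P (heavy_measurable m i); exact: heavyE.
  rewrite [leRHS](eq_bigr (fun=> e)) //.
  by rewrite !big_const_nat !subn0 !iter_addr_0 -(mulr_natl b) -(mulr_natl e).
rewrite leNgt; apply/negP => lt.
have e0 : 0 <= e by apply: mean_ge0.
pose M := (Num.truncn (m%:R * e / (lam * b - e))).+1.
have d0 : 0 < lam * b - e by rewrite subr_gt0.
have := key M; rewrite natrD mulrDl => kM.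
have : m%:R * e / (lam * b - e) < M%:R by exact: truncnS_gt.
by rewrite ltr_pdivrMr //; nra.
Qed.

Lemma ever_heavy_prob_le :
  exists B : set T, [/\ measurable B, (forall w, ~ B w -> forall m, ~~ heavy (z w) lam m 0) &
    lam * prob P B <= mean P (fun w => f (seg 0 L w))].
Proof.
pose F m := [set w | heavy (z w) lam m 0].
have mF m : measurable (F m) by apply: heavy_measurable.
have mB : measurable (\bigcup_m F m) by apply: bigcupT_measurable.
exists (\bigcup_m F m); split => //.
  by move=> w nB m; apply/negP => h; apply: nB; exists m.
have ndF : nondecreasing_seq F.
  move=> m m' mm'; apply/subsetPset => w /existsP[l hl]; apply/existsP.
  by exists (widen_ord mm' l).
have cv := nondecreasing_cvg_mu (mu := P) mF mB ndF.
rewrite mulrC -ler_pdivlMr // -lee_fin -probE //.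
rewrite -(cvg_lim _ cv) //; apply: lime_le.
  by apply/cvg_ex; exists (P (\bigcup_m F m)).
apply: nearW => m /=; rewrite probE // lee_fin ler_pdivlMr // mulrC.
exact: heavy_prob_le.
Qed.

End MaximalInequality.

(** Truncation at level K, losing at most 1 in mean. A fixed loss is affordable: it is incurred once
    per block of length l, and l will be large. *)
Lemma travel_tail_cvg l : exists K : nat,
  travel_mean l - 1 <=
    \sum_(0 <= j < K) prob P (seg 0 l @^-1` [set h | (j < passage h)%N]).
Proof.
have h := integral_tail P (travel_rv 0 l).
rewrite (meanE (nnint_travel 0 l)) in h.
apply: contrapT => hK.
suff : ((travel_mean l)%:E <= (travel_mean l - 1)%:E)%E.
  by rewrite lee_fin; lra.
rewrite {1}/travel_mean h; apply: lime_le.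
  by apply: is_cvg_nneseries => j _ _; rewrite lee_fin prob_ge0.
apply: nearW => K; rewrite sumEFin lee_fin leNgt; apply/negP => lt.
by apply: hK; exists K; apply: ltW.
Qed.

(** * The law of large numbers for passage times *)

Section Speed.
Variable g : R.
Hypothesis gP : forall l, (0 < l)%N -> travel_mean l <= g * l%:R <= travel_mean l + load_mean.

Lemma load_mean_ge0 : 0 <= load_mean.
Proof. exact: mean_ge0. Qed.

Lemma travel_blocks l m w : \sum_(0 <= k < m) travel (k * l) l w <= travel 0 (m * l) w.
Proof.
elim: m => [|m IH]; first by rewrite big_geq.
rewrite big_nat_recr //= mulSn addnC; apply: le_trans (travel_superadd 0 (m * l) l w).
by rewrite lerD2r.
Qed.

(** Each block is bounded below by its K indicators of j < D_l, whose frequencies concentrate. Per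
    block, the loss is [load_mean] from the speed, 1 from truncation and 2 from fluctuations. *)
Lemma lower_deviation l K m : (0 < l)%N -> (0 < m)%N ->
  travel_mean l - 1 <=
    \sum_(0 <= j < K) prob P (seg 0 l @^-1` [set h | (j < passage h)%N]) ->
  (K * K.+1 <= m)%N ->
  nnint P (fun w => Num.max 0 (g * (m * l)%:R - travel 0 (m * l) w)) /\
  mean P (fun w => Num.max 0 (g * (m * l)%:R - travel 0 (m * l) w)) <= m%:R * (load_mean + 3).
Proof.
move=> l0 m0 hK Km.
pose pr j := prob P (seg 0 l @^-1` [set h | (j < passage h)%N]).
have {}hK : travel_mean l - 1 <= \sum_(0 <= j < K) pr j := hK.
pose cnt j w : R := \sum_(0 <= k < m) (j < passage (seg (k * l) l w))%N%:R.
(* With del = 1 / (K + 1) the K deviations add up to at most m + K (K + 1) <= 2 m. *)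
have K0 : 0 < K.+1%:R^-1 :> R by rewrite invr_gt0.
have dev j := @block_frequency_L1 l (fun h => (j < passage h)%N) m _ K0 m0.
have [h1 e1] := nnint_sum (index_iota 0 K) (fun j => (dev j).1).
have c0 : 0 <= m%:R * (load_mean + 1) by rewrite mulr_ge0 // addr_ge0 // load_mean_ge0.
have [h2 e2] := nnint_cst P c0.
have [h3 e3] := nnintD h1 h2.
have [] := nnint_le (f := fun w => Num.max 0 (g * (m * l)%:R - travel 0 (m * l) w)) h3.
- apply: measurable_maxr => //.
  by apply: measurable_funB => //; apply: travel_measurable.
- move=> w; rewrite le_max lexx /= ge_max; apply/andP; split.
    by case: h3 => + _ _; apply.
  have cntV : \sum_(0 <= j < K) cnt j w <= travel 0 (m * l) w.
    apply: le_trans (travel_blocks l m w).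
    rewrite /cnt exchange_big /=; apply: ler_sum => k _.
    rewrite /travel -natr_sum ler_nat.
    elim: (K) (passage _) => [|K' IH] v; first by rewrite big_geq.
    rewrite big_nat_recl //=; case: v => [|v]; first by rewrite big1.
    by rewrite add1n ltnS; apply: IH.
  have devs : \sum_(0 <= j < K) (m%:R * pr j - cnt j w) <=
      \sum_(0 <= j < K) `|cnt j w - m%:R * pr j|.
    by apply: ler_sum => j _; rewrite distrC ler_norm.
  rewrite sumrB -mulr_sumr in devs.
  have /andP[_ gl] := gP l0.
  rewrite natrM.
  have mm : 0 <= m%:R :> R by [].
  have := ler_wpM2l mm hK; have := ler_wpM2l mm gl; rewrite -/pr.
  by move: devs cntV; rewrite /cnt; lra.
move=> h4 h5; split => //; apply: le_trans h5 _; rewrite e3 e1 e2.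
have : \sum_(0 <= j < K) mean P (fun w => `|cnt j w - m%:R * pr j|) <= m%:R * 2.
  apply: (@le_trans _ _ (\sum_(0 <= j < K) (K.+1%:R^-1 * m%:R + K.+1%:R))).
    apply: ler_sum => j _; have [_] := dev j; by rewrite invrK.
  rewrite big_const_nat subn0 iter_addr_0 -(mulr_natl (_ + _)) mulrDr -natrM.
  rewrite mulr2n mulrDr mulr1; apply: lerD; last by rewrite ler_nat.
  by rewrite mulrA ler_piMl // ler_pdivrMr // mul1r ler_nat.
by rewrite /cnt; lra.
Qed.

(** The second term is the price of subadditivity when the block is appended; thus sums of defects
    dominate the deviation of the whole path. *)
Definition block_defect L (h : seq E) : R :=
  `|(passage h)%:R - g * L%:R| + (entry_sum (head [ffun=> 0%N] h))%:R.

(** For x = D_L - g L one has |x| = x + 2 max(0, -x) and E x <= 0, so that lower deviations control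
    the mean of |x|. *)
Lemma block_defect_small eta : 0 < eta -> exists2 L, (0 < L)%N &
  nnint P (fun w => block_defect L (seg 0 L w)) /\
  mean P (fun w => block_defect L (seg 0 L w)) <= eta * L%:R.
Proof.
move=> eta0.
have C0 := load_mean_ge0.
(* The total mean is at most 2 m (C + 3) + C <= 3 m (C + 3) with C = [load_mean], to be compared
   with eta m l. *)
pose l := (Num.truncn (3 * (load_mean + 3) / eta)).+1.
have hl : 3 * (load_mean + 3) <= eta * l%:R.
  by rewrite [leRHS]mulrC -ler_pdivrMr //; apply: ltW; apply: truncnS_gt.
have [K hK] := travel_tail_cvg l.
pose m := (K * K.+1).+1.
have [h1 e1] := @lower_deviation l K m isT isT hK (leqnSn _).
exists (m * l)%N => //.
set L := (m * l)%N in h1 e1 *.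
have [h2 e2] := nnintZ (ler0n R 2) h1.
have [h3 e3] := nnintD (nnint_travel 0 L) h2.
have m1 : measurable_fun setT (fun w => `|travel 0 L w - g * L%:R|).
  apply: measurableT_comp => //; apply: measurable_funB => //.
  exact: travel_measurable.
have gL : 0 <= g * L%:R.
  by have /andP[+ _] := gP (isT : (0 < L)%N); apply: le_trans; apply: travel_mean_ge0.
have absE w : `|travel 0 L w - g * L%:R| + g * L%:R =
    travel 0 L w + 2 * Num.max 0 (g * L%:R - travel 0 L w).
  case: (leP 0 (g * L%:R - travel 0 L w)) => s.
    by rewrite distrC ger0_norm //; lra.
  by rewrite ger0_norm ?mulr0 ?addr0 ?subrK //; lra.
have le3 w : 0 <= `|travel 0 L w - g * L%:R| <=
    travel 0 L w + 2 * Num.max 0 (g * L%:R - travel 0 L w).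
  by rewrite normr_ge0 /= -absE lerDl.
have [h5 _] := nnint_le h3 m1 le3.
have [hg eg] := nnint_cst P gL.
have [_ e6] := nnintD h5 hg.
have [h7 e7] := nnintD h5 (nnint_load 0).
have L0 : (0 < L)%N by [].
have eF : (fun w => `|travel 0 L w - g * L%:R| + load 0 w) = (fun w => block_defect L (seg 0 L w)).
  by apply/funext => w; rewrite /block_defect; case: (L) L0.
rewrite eF in h7 e7; split => //; rewrite e7.
rewrite (funext absE) e3 e2 travel_meanE eg in e6.
have /andP[tg _] := gP L0.
have lm : load_mean + 3 <= m%:R * (load_mean + 3) by rewrite ler_peMl ?ler1n //; lra.
have : m%:R * (3 * (load_mean + 3)) <= m%:R * (eta * l%:R) by rewrite ler_wpM2l.
have -> : eta * L%:R = m%:R * (eta * l%:R) by rewrite /L natrM mulrCA.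
rewrite -/load_mean; lra.
Qed.

Lemma travel_mono s t w : (s <= t)%N -> travel 0 s w <= travel 0 t w.
Proof.
move=> st; rewrite -(subnKC st); apply: le_trans (travel_superadd _ _ _ _).
by rewrite lerDl.
Qed.

Lemma block_defect_sum L m w : (0 < L)%N ->
  `|travel 0 (m * L) w - g * (m * L)%:R| <=
  \sum_(0 <= k < m) block_defect L (seg (k * L) L w).
Proof.
move=> L0; elim: m => [|m IH].
  by rewrite big_geq // mul0n mulr0 subr0 /travel passage_nil normr0.
rewrite big_nat_recr //= mulSn addnC natrD mulrDr.
have -> : block_defect L (seg (m * L) L w) = `|travel (m * L) L w - g * L%:R| + load (m * L) w.
  by rewrite /block_defect /load /travel; case: (L) L0.
have h1 := travel_superadd 0 (m * L) L w; have h2 := travel_subadd 0 (m * L) L w.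
rewrite add0n in h1 h2.
have l0 : 0 <= load (m * L) w by rewrite ler0n.
move: IH; rewrite ler_norml => /andP[i1 i2].
have := ler_norm (travel (m * L) L w - g * L%:R).
have := lerNnormlW (lexx `|travel (m * L) L w - g * L%:R|).
by rewrite ler_norml => ? ?; apply/andP; split; lra.
Qed.

(** Outside the maximal event all multiples of L satisfy the estimate with eps / 2, and monotonicity
    in time handles the times between them. *)
Lemma speed_nearly eps rho : 0 < eps -> 0 < rho -> exists B, [/\ measurable B, prob P B <= rho &
  forall w, ~ B w -> exists t0, forall t, (t0 <= t)%N ->
    `|travel 0 t w - g * t%:R| <= eps * t%:R].
Proof.
move=> eps0 rho0.
(* Defects of mean at most rho (eps / 2) L, tested at level (eps / 2) L, leave an exceptional set of
   probability at most rho. *)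
have er0 : 0 < rho * (eps / 2) by rewrite mulr_gt0 // divr_gt0.
have [L L0 [hz mz]] := block_defect_small er0.
have LR : 0 < L%:R :> R by rewrite ltr0n.
have lam0 : 0 < eps / 2 * L%:R by rewrite mulr_gt0 // divr_gt0.
have bd0 h : 0 <= block_defect L h by rewrite addr_ge0.
have [B [mB hB pB]] := ever_heavy_prob_le bd0 hz lam0.
exists B; split => //.
  rewrite -(ler_pM2l lam0); apply: le_trans pB _; apply: le_trans mz _.
  by rewrite le_eqVlt; apply/orP; left; apply/eqP; ring.
move=> w nB.
have dev m : `|travel 0 (m * L) w - g * (m * L)%:R| <= eps / 2 * (m * L)%:R.
  apply: le_trans (block_defect_sum m w L0) _.
  case: m => [|m]; first by rewrite big_geq // mul0n mulr0.
  have := hB w nB m.+1; rewrite negb_exists => /forallP /(_ ord_max).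
  by rewrite add0n -leNgt natrM mulrCA mulrC [m.+1%:R * _]mulrC.
have g0 : 0 <= g.
  have /andP[+ _] := gP L0; move=> h; have := le_trans (travel_mean_ge0 L) h.
  by rewrite pmulr_lge0.
(* From this time on, rounding t to a multiple of L costs at most (g + eps) L <= (eps / 2) t. *)
exists (Num.truncn ((g + eps) * L%:R / (eps / 2))).+1 => t tt.
have tR : (g + eps) * L%:R <= t%:R * (eps / 2).
  rewrite -ler_pdivrMr ?divr_gt0 //; apply: ltW; apply: lt_le_trans (truncnS_gt _) _.
  by rewrite ler_nat.
pose m := (t %/ L)%N.
have t1 : (m * L <= t)%N by apply: leq_trunc_div.
have t2 : (t <= m.+1 * L)%N by rewrite ltnW // ltn_ceil.
have a1 := travel_mono w t1; have a2 := travel_mono w t2.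
have := dev m; have := dev m.+1; rewrite !ler_norml => /andP[_ d2] /andP[d1 _].
have s1 : (m * L)%:R <= t%:R :> R by rewrite ler_nat.
have s2 : t%:R <= (m * L)%:R + L%:R :> R by rewrite -natrD ler_nat addnC -mulSn.
rewrite mulSn natrD in d2.
have gs2 := ler_wpM2l g0 s2; have gs1 := ler_wpM2l g0 s1.
have es1 := ler_wpM2l (ltW eps0) s1.
have eL : 0 <= eps * L%:R by rewrite mulr_ge0 // ltW.
have gL : 0 <= g * L%:R by rewrite mulr_ge0 // ltW.
apply/andP; split; nra.
Qed.

Lemma speed_ae eps : 0 < eps -> {ae P, forall w, exists t0, forall t, (t0 <= t)%N ->
    `|travel 0 t w - g * t%:R| <= eps * t%:R}.
Proof.
move=> eps0.
have rho0 j : 0 < j.+1%:R^-1 :> R by rewrite invr_gt0.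
have /choice[B hB] := fun j => speed_nearly eps0 (rho0 j).
exists (\bigcap_j B j); split.
- by apply: bigcapT_measurable => j; have [] := hB j.
- have mI : measurable (\bigcap_j B j).
    by apply: bigcapT_measurable => j; have [] := hB j.
  rewrite probE //; congr EFin; apply/eqP; rewrite eq_le prob_ge0 andbT.
  apply/ler_addgt0Pl => e e0; rewrite addr0.
  pose j := Num.truncn e^-1.
  have [mj pj _] := hB j.
  apply: le_trans (prob_le P mI mj _) _; first by move=> w; apply.
  apply: le_trans pj _; rewrite -[leRHS]invrK lef_pV2 ?posrE ?invr_gt0 //.
  by apply: ltW; apply: truncnS_gt.
- move=> w nw j _; apply: contrapT => nB; apply: nw => /=.
  by have [_ _] := hB j; apply.
Qed.

(** * The front process *)

Definition frontier t w : {set 'I_n.+1} := front (minplus_run (flat n 0) (seg 0 t w)).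

Definition success t w : {set 'I_n.+1} := hit (frontier t w) (H t w).

Lemma seg_S t w : seg 0 t.+1 w = rcons (seg 0 t w) (H t w).
Proof. by have := seg_cat 0 t 1 w; rewrite addn1 cats1. Qed.

Lemma frontier_rv t : discrete_rv (frontier t).
Proof. exact: (discrete_rv_comp (fun h => front (minplus_run (flat n 0) h)) (seg_rv 0 t)). Qed.

Lemma frontier_noise_indep t F e :
  prob P (frontier t @^-1` [set F] `&` H t @^-1` [set e]) =
  prob P (frontier t @^-1` [set F]) * prob P (H t @^-1` [set e]).
Proof.
have h1 : H t @^-1` [set e] = seg t 1 @^-1` [set [:: e]].
  by apply/seteqP; split => w; rewrite /seg /=; [move=> ->|case].
rewrite h1; apply: (prob_indep (seg_rv 0 t) (seg_rv t 1) _
  [set h | front (minplus_run (flat n 0) h) = F] [set [:: e]]) => h h'.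
exact: seg_indep.
Qed.

Lemma rectangle_prob t (A F : {set 'I_n.+1}) l :
  prob P (H t @^-1` [set e : E | [forall i in A, forall j in F, (l <= e (i, j))%N]]) =
  r l ^+ (#|A| * #|F|).
Proof.
rewrite -finset.cardsX -(H_tail t); congr prob; apply/seteqP; split => w /= h.
  apply/forallP => -[i j]; apply/implyP; rewrite finset.in_setX /= => /andP[iA jF].
  by move/forallP/(_ i)/implyP/(_ iA)/forallP/(_ j)/implyP/(_ jF): h.
apply/forallP => i; apply/implyP => iA; apply/forallP => j; apply/implyP => jF.
by move/forallP/(_ (i, j))/implyP: h; rewrite finset.in_setX iA jF; apply.
Qed.

Lemma frontier_rectangle_prob t (A : {set 'I_n.+1}) l :
  prob P [set w | [forall i in A, forall j in frontier t w, (l <= H t w (i, j))%N]] =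
  fmean P (frontier t) (fun F => r l ^+ (#|A| * #|F|)).
Proof.
rewrite (prob_freeze (fun F : {set 'I_n.+1} =>
   [set e : E | [forall i in A, forall j in F, (l <= e (i, j))%N]])
   (frontier_rv t) (@H_rv t) (frontier_noise_indep t)).
by apply: eq_bigr => F _; rewrite rectangle_prob.
Qed.

Local Notation q := (r 1).

Lemma success_rv t : discrete_rv (success t).
Proof.
exact: (discrete_rv_comp (fun Fe => hit Fe.1 Fe.2) (discrete_rv_pair (frontier_rv t) (@H_rv t))).
Qed.

Lemma prod_set_split (f : 'I_n.+1 -> R) c (A : {set 'I_n.+1}) :
  \prod_i (if i \in A then f i else c) = (\prod_(i in A) f i) * c ^+ (n.+1 - #|A|).
Proof.
rewrite (bigID (mem A)) /=; congr (_ * _).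
  by apply: eq_bigr => i ->.
rewrite (eq_bigr (fun=> c)); last by move=> i /negPf ->.
by rewrite prodr_const -[X in (X - _)%N](card_ord n.+1) -(cardC (mem A)) addKn.
Qed.

(* Each vertex of A independently tags itself with probability 1 - u, so that
   u^|S| is the probability that no tag falls in S. *)
Lemma expr_card_tags (u : R) (S : {set 'I_n.+1}) :
  u ^+ #|S| = \sum_(A : {set 'I_n.+1})
    (1 - u) ^+ #|A| * u ^+ (n.+1 - #|A|) * (fintype.disjoint (mem A) (mem S))%:R.
Proof.
transitivity (\prod_(i : 'I_n.+1) ((1 - u) * (i \notin S)%:R + u)).
  rewrite (bigID (mem S)) /= [X in _ * X]big1 ?mulr1; last first.
    by move=> i ->; rewrite mulr1 subrK.
  rewrite (eq_bigr (fun=> u)); last by move=> i ->; rewrite mulr0 add0r.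
  by rewrite prodr_const.
rewrite bigA_distr; apply: eq_bigr => A _.
rewrite prod_set_split big_split /= prodr_const.
rewrite mulrAC; congr (_ * _ * _).
have [dis|ndis] := boolP (fintype.disjoint (mem A) (mem S)).
  by rewrite big1 // => i iA; rewrite (fintype.disjointFr dis iA).
move: ndis; rewrite fintype.disjoint_subset => /subsetPn[i iA]; rewrite !inE negbK => iS.
by rewrite (bigD1 i) //= iS mul0r.
Qed.

(** A avoids S_t exactly when all entries with row in A and column in F_t are positive; freezing F_t
    makes this a rectangle event. *)
Lemma success_disjoint_prob t (A : {set 'I_n.+1}) :
  fmean P (success t) (fun S => (fintype.disjoint (mem A) (mem S))%:R) =
  fmean P (frontier t) (fun F => (q ^+ #|F|) ^+ #|A|).
Proof.
rewrite (fmean_prob P (fun S : {set 'I_n.+1} => fintype.disjoint (mem A) (mem S)) (success_rv t)).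
transitivity (fmean P (frontier t) (fun F => q ^+ (#|A| * #|F|))); last first.
  by apply: eq_bigr => F _; rewrite -exprM mulnC.
rewrite -frontier_rectangle_prob; congr prob; apply/seteqP; split => w /=.
  move=> dis; apply/forallP => i; apply/implyP => iA; apply/forallP => j; apply/implyP => jF.
  have := fintype.disjointFr dis iA; rewrite /success /hit inE => /negbT.
  by rewrite negb_exists => /forallP/(_ j); rewrite jF /= lt0n.
move=> /forallP h; apply/pred0P => i /=; apply/negbTE/negP => /andP[iA].
rewrite /success /hit finset.in_set => /existsP[j /andP[jF /eqP e0]].
by move/implyP/(_ iA)/forallP/(_ j)/implyP/(_ jF): (h i); rewrite e0.
Qed.

(** The tag expansion reduces u^|S| to avoidance probabilities, and distributivity resums them with
    q^|F| in place of the indicator that a tagged vertex lies outside S. *)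
Lemma success_gf t (u : R) :
  fmean P (success t) (fun S => u ^+ #|S|) =
  fmean P (frontier t) (fun F => (u + (1 - u) * q ^+ #|F|) ^+ n.+1).
Proof.
transitivity (fmean P (success t) (fun S => \sum_(A : {set 'I_n.+1})
    (1 - u) ^+ #|A| * u ^+ (n.+1 - #|A|) * (fintype.disjoint (mem A) (mem S))%:R)).
  by apply: eq_bigr => S _; rewrite -expr_card_tags.
rewrite fmean_sum.
under eq_bigr => A _ do rewrite fmeanZ success_disjoint_prob -fmeanZ.
rewrite -fmean_sum; apply: eq_bigr => F _; congr (_ * _).
have -> : (u + (1 - u) * q ^+ #|F|) ^+ n.+1 = \prod_(i : 'I_n.+1) ((1 - u) * q ^+ #|F| + u).
  by rewrite prodr_const card_ord addrC.
rewrite bigA_distr; apply: eq_bigr => A _.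
by rewrite prod_set_split prodr_const exprMn mulrAC.
Qed.

Definition front_gf t (u : R) : R := fmean P (frontier t) (fun F => u ^+ #|F|).

Lemma frontier_gt0 t w : (0 < #|frontier t w|)%N.
Proof. exact: front_gt0. Qed.

Lemma frontier_le t w : (#|frontier t w| <= n.+1)%N.
Proof. by rewrite -[X in (_ <= X)%N]card_ord max_card. Qed.

Lemma frontier_S t w : success t w != finset.set0 -> frontier t.+1 w = success t w.
Proof. by move=> h; rewrite /frontier seg_S minplus_run_rcons front_step. Qed.

(** Means over S_t and over the next front are brought to one finite law, where the two sets can be
    compared pointwise. *)
Let joint t w := (frontier t w, (success t w, frontier t.+1 w)).
Let joint_rv t : discrete_rv (joint t).
Proof.
apply: discrete_rv_pair; first exact: frontier_rv.
apply: discrete_rv_pair; [exact: success_rv|exact: frontier_rv].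
Qed.

Let joint2 t f : fmean P (success t) f = fmean P (joint t) (fun v => f v.2.1).
Proof. exact: (fmean_comp P (fun v => v.2.1) f (joint_rv t)). Qed.
Let joint3 t f : fmean P (frontier t.+1) f = fmean P (joint t) (fun v => f v.2.2).
Proof. exact: (fmean_comp P (fun v => v.2.2) f (joint_rv t)). Qed.

(** If S_t is empty, the next front F still satisfies u^|F| <= u, which improves on u^|S| = 1 by 1 -
    u. The indicator of this event is 0^|S|, with mean given by the generating function at 0. *)
Lemma front_gf_upper t u : 0 <= u <= 1 ->
  front_gf t.+1 u <= fmean P (frontier t) (fun F =>
     (u + (1 - u) * q ^+ #|F|) ^+ n.+1 - (1 - u) * (q ^+ #|F|) ^+ n.+1).
Proof.
move=> /andP[u0 u1].
have e0 := success_gf t 0; have eu := success_gf t u.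
rewrite /front_gf.
have -> : fmean P (frontier t) (fun F =>
     (u + (1 - u) * q ^+ #|F|) ^+ n.+1 - (1 - u) * (q ^+ #|F|) ^+ n.+1) =
   fmean P (success t) (fun S => u ^+ #|S| + (u - 1) * 0 ^+ #|S|).
  rewrite (fmean_affine P _ (u - 1) (fun S : {set 'I_n.+1} => u ^+ #|S|)
    (fun S => 0 ^+ #|S|)) e0 eu.
  rewrite -fmean_affine; apply: eq_bigr => F _.
  by congr (_ * _); rewrite add0r subr0 mul1r; ring.
rewrite joint2 joint3; apply: fmean_le => w /=.
have [S0|S0] := eqVneq (success t w) finset.set0.
  rewrite S0 finset.cards0 !expr0 mulr1 addrC subrK.
  have := frontier_gt0 t.+1 w; case: #|_| => // m _.
  by rewrite exprS ler_piMr // exprn_ile1.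
by rewrite frontier_S // expr0n finset.cards_eq0 (negPf S0) mulr0 addr0.
Qed.

Lemma front_gf_lower t u : 0 <= u ->
  fmean P (frontier t) (fun F =>
     (u + (1 - u) * q ^+ #|F|) ^+ n.+1 - (q ^+ #|F|) ^+ n.+1) <= front_gf t.+1 u.
Proof.
move=> u0.
have e0 := success_gf t 0; have eu := success_gf t u.
rewrite /front_gf.
have -> : fmean P (frontier t) (fun F =>
     (u + (1 - u) * q ^+ #|F|) ^+ n.+1 - (q ^+ #|F|) ^+ n.+1) =
   fmean P (success t) (fun S => u ^+ #|S| + (- 1) * 0 ^+ #|S|).
  rewrite (fmean_affine P _ (- 1) (fun S : {set 'I_n.+1} => u ^+ #|S|)
    (fun S => 0 ^+ #|S|)) e0 eu.
  rewrite -fmean_affine; apply: eq_bigr => F _.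
  by congr (_ * _); rewrite add0r subr0 mul1r mulN1r.
rewrite joint2 joint3; apply: fmean_le => w /=.
have [S0|S0] := eqVneq (success t w) finset.set0.
  by rewrite S0 finset.cards0 !expr0 mulr1 subrr exprn_ge0.
by rewrite frontier_S // expr0n finset.cards_eq0 (negPf S0) mulr0 addr0.
Qed.

Definition jump t w : nat := (passage (seg 0 t.+1 w) - passage (seg 0 t w))%N.

Lemma jump_rv t : discrete_rv (jump t).
Proof.
exact: (discrete_rv_comp (fun v => (v.1 - v.2)%N) (discrete_rv_pair (travel_rv 0 t.+1) (travel_rv 0 t))).
Qed.

Lemma jump_tail t l :
  prob P [set w | (l < jump t w)%N] <= fmean P (frontier t) (fun F => (r l.+1 ^+ #|F|) ^+ n.+1).
Proof.
have -> : fmean P (frontier t) (fun F => (r l.+1 ^+ #|F|) ^+ n.+1) =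
    fmean P (frontier t) (fun F => r l.+1 ^+ (#|finset.setT : {set 'I_n.+1}| * #|F|)).
  by apply: eq_bigr => F _; rewrite finset.cardsT card_ord -exprM mulnC.
rewrite -frontier_rectangle_prob; apply: prob_le.
- exact: (jump_rv t [set m | (l < m)%N]).
- exact: (discrete_rv_pair (frontier_rv t) (@H_rv t)
    [set Fe : {set 'I_n.+1} * E | [forall i in finset.setT, forall j in Fe.1, (l < Fe.2 (i, j))%N]]).
- move=> w /=; rewrite /jump /passage seg_S minplus_run_rcons => h.
  have /forallP hh := ffmin_step_ltP h.
  by apply/forallP => i; apply/implyP => _; apply: hh.
Qed.

Lemma jump_pos t : fmean P (frontier t) (fun F => (q ^+ #|F|) ^+ n.+1) = prob P [set w | (0 < jump t w)%N].
Proof.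
have e0 := success_gf t 0.
transitivity (fmean P (success t) (fun S => (S == finset.set0)%:R)).
  rewrite -[RHS](_ : fmean P (success t) (fun S => 0 ^+ #|S|) = _).
    by rewrite e0; apply: eq_bigr => F _; rewrite add0r subr0 mul1r.
  by apply: eq_bigr => S _; rewrite expr0n finset.cards_eq0.
rewrite (fmean_prob P (fun S : {set 'I_n.+1} => S == finset.set0) (success_rv t)).
congr prob; apply/seteqP; split => w /=;
  by rewrite /jump /passage seg_S minplus_run_rcons subn_gt0 ffmin_step_hit.
Qed.

(** * Two-sided bounds on the speed *)

Section RateBounds.
Let N := n.+1.
Let c := q ^+ N.
Hypotheses (q_gt0 : 0 < q) (q_lt1 : q < 1).

Let q_ge0 : 0 <= q := ltW q_gt0.

Let qF_bounds t w : c <= q ^+ #|frontier t w| <= q.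
Proof.
apply/andP; split.
  by rewrite /c ler_wiXn2l // ?ltW // frontier_le.
have := frontier_gt0 t w; case: #|_| => // m _.
by rewrite exprS ler_piMr // exprn_ile1 // ltW.
Qed.

(** With x = q^|F|, the power x^b is (q^b)^|F|, so the binomial expansion closes on the arguments
    q^b. Its top term (1 - u)^N x^N is absorbed by the correction for an empty S_t. *)
Lemma front_gf_upper_step t a :
  front_gf t.+1 (q ^+ a) <= \sum_(0 <= b < N)
    'C(N, b)%:R * (1 - q ^+ a) ^+ b * q ^+ (a * (N - b)) * front_gf t (q ^+ b).
Proof.
set u := q ^+ a.
have u01 : 0 <= u <= 1 by rewrite exprn_ge0 ?exprn_ile1 // ltW.
have /andP[u0 u1] := u01.
apply: le_trans (front_gf_upper t u01) _.
rewrite /front_gf; under [leRHS]eq_bigr => b _ do rewrite -fmeanZ.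
rewrite -fmean_sum; apply: fmean_le => w.
set x := q ^+ _.
have x0 : 0 <= x by rewrite exprn_ge0.
rewrite exprDn big_ord_recr /= subnn expr0 mul1r binn mulr1n exprMn.
rewrite -[leRHS]addr0 -addrA lerD //.
  rewrite -(big_mkord xpredT (fun i => u ^+ (N - i) * ((1 - u) * x) ^+ i *+ 'C(N, i))).
  apply: ler_sum => b _; rewrite -[leLHS]mulr_natl exprM -/u exprMn.
  rewrite (_ : (q ^+ b) ^+ _ = x ^+ b); last by rewrite /x -!exprM mulnC.
  rewrite le_eqVlt; apply/orP; left; apply/eqP.
  move: ('C(N, b)%:R) (u ^+ (N - b)) ((1 - u) ^+ b) (x ^+ b) => c1 c2 c3 c4.
  by rewrite mulrCA !mulrA [c1 * c3 * _]mulrAC [c2 * c1]mulrC.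
rewrite subr_le0 ler_wpM2r ?exprn_ge0 // exprS ler_piMr ?subr_ge0 // exprn_ile1 ?subr_ge0 //.
by rewrite lerBlDr lerDl.
Qed.

Lemma frontier0 w : frontier 0 w = finset.setT.
Proof.
apply/setP => i; rewrite finset.in_setT /frontier /front finset.in_set /seg /=.
by have [j ->] := ffmin_ex (flat n 0); rewrite !ffunE.
Qed.

Lemma front_gf0 u : front_gf 0 u = u ^+ N.
Proof.
rewrite /front_gf -[RHS](fmean_cst P _ (frontier_rv 0)); apply/eqP; rewrite eq_le.
by apply/andP; split; apply: fmean_le => w; rewrite frontier0 finset.cardsT card_ord.
Qed.

Lemma front_gf_le eps t : 0 <= eps -> eps < 1 ->
  (forall x, 0 <= x <= 1 ->
    \sum_(1 <= b < N) 'C(N, b)%:R * x ^+ b * ((1 + q ^+ (N - b)) ^+ N - 1) <=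
    eps * ((1 + x) ^+ N - 1)) ->
  front_gf t c <= c ^+ N * 2 ^+ N * (1 - eps)^-1.
Proof.
move=> eps0 eps1 ex.
have i1 : 1 <= (1 - eps)^-1 by rewrite invf_ge1 ?subr_gt0 // lerBlDr lerDl.
have := @gf_supersolution R q N eps q_gt0 q_lt1 isT eps0 eps1 ex
  (fun t a => front_gf t (q ^+ a)) _ _ front_gf_upper_step t N.
rewrite leqnn /= => h; apply: le_trans (h _ _ isT) _.
- by move=> s; rewrite /front_gf -[RHS](fmean_cst P 1 (frontier_rv s)); apply: eq_bigr => F _; rewrite expr0 expr1n.
- by move=> a; rewrite front_gf0 exprM.
- rewrite exprM -/c -mulrA ler_wpM2l ?exprn_ge0 // subnn expr0.
  rewrite (_ : 1 + 1 = 2) // mulrBr mulr1.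
  by rewrite mulrC; lra.
Qed.

Lemma front_gf_ge t : 1 <= n%:R * (1 / q - 1) * (1 - q) ->
  (c + (1 - c) * c) ^+ N - c ^+ N <= front_gf t.+1 c.
Proof.
move=> hN.
have c0 : 0 < c by rewrite exprn_gt0.
have cq : c <= q by rewrite /c exprS ler_piMr // exprn_ile1 // ltW.
apply: le_trans (front_gf_lower t (ltW c0)).
rewrite -[leLHS](fmean_cst P _ (frontier_rv t)); apply: fmean_le => w.
have /andP[h1 h2] := qF_bounds t w.
exact: (binom_sub_mono q_gt0 q_lt1 (ltW c0) cq hN h1 h2 c0).
Qed.

Lemma travel_S t w : travel 0 t.+1 w = travel 0 t w + (jump t w)%:R.
Proof.
rewrite /travel /jump -natrD subnKC // seg_S; exact: passage_rcons.
Qed.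

Lemma nnint_jump t : nnint P (fun w => (jump t w)%:R).
Proof.
have [] := nnint_le (nnint_travel 0 t.+1) (discrete_measurable_fun (fun k => k%:R) (jump_rv t)) _ => //.
by move=> w; rewrite ler0n /= travel_S lerDr.
Qed.

Lemma travel_mean_jumps m : travel_mean m = \sum_(0 <= t < m) mean P (fun w => (jump t w)%:R).
Proof.
have [_ <-] := nnint_sum (index_iota 0 m) nnint_jump.
congr (mean P _); apply/funext => w; elim: m => [|m IH].
  by rewrite big_geq // /travel passage_nil.
by rewrite big_nat_recr //= -IH travel_S.
Qed.

Let front_gfc t : fmean P (frontier t) (fun F => (q ^+ #|F|) ^+ N) = front_gf t c.
Proof. by apply: eq_bigr => F _; rewrite -!exprM mulnC. Qed.

Lemma jump_mean_ge t : front_gf t c <= mean P (fun w => (jump t w)%:R).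
Proof.
rewrite -front_gfc jump_pos.
have mb : measurable [set w | (0 < jump t w)%N] by apply: (jump_rv t [set m | (0 < m)%N]).
have [h e] := nnint_bool P mb; rewrite -e.
have le w : 0 <= ((0 < jump t w)%N%:R : R) <= (jump t w)%:R.
  by rewrite ler0n ler_nat; case: (jump t w).
by have [_ mh _] := h; have [_] := nnint_le (nnint_jump t) mh le.
Qed.

Lemma r_noninc l : r l.+1 <= r l.
Proof.
have := H_tail 0 (finset.set1 (ord0, ord0)) l; have := H_tail 0 (finset.set1 (ord0, ord0)) l.+1.
rewrite finset.cards1 !expr1 => <- <-.
have mE k : measurable [set w | [forall p in finset.set1 (ord0 : 'I_n.+1, ord0 : 'I_n.+1), (k <= H 0 w p)%N]].
  exact: (@H_rv 0 [set e : E | [forall p in finset.set1 (ord0, ord0), (k <= e p)%N]]).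
apply: prob_le => // w /forallP h; apply/forallP => p; apply/implyP => hp.
by have /implyP/(_ hp) := h p; apply: leq_trans.
Qed.

Lemma mu_ge0 : 0 <= mu.
Proof. by have := r_sum 0; rewrite big_geq. Qed.

(** Increases beyond 1 are rare: for l >= 1 the ratio (r (l + 1) / q)^(N |F|) is at most (r 2 / q)^n
    (r (l + 1) / q) because |F| >= 1, and the last factor is summable in l by the first moment. *)
Lemma jump_mean_le t : mean P (fun w => (jump t w)%:R) <=
  (1 + (r 2 / q) ^+ n * (mu / q)) * front_gf t c.
Proof.
rewrite -lee_fin -(meanE (nnint_jump t)) (integral_tail P (jump_rv t)).
apply: lime_le.
  by apply: is_cvg_nneseries => l _ _; rewrite lee_fin prob_ge0.
have fg0 : 0 <= front_gf t c.
  by rewrite -front_gfc jump_pos prob_ge0.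
have s0 : 0 <= r 2 / q by rewrite divr_ge0 // r_ge0.
have step l : prob P [set w | (l.+1 < jump t w)%N] <= (r 2 / q) ^+ n * (r l.+2 / q) * front_gf t c.
  apply: le_trans (jump_tail t l.+1) _.
  rewrite -front_gfc -fmeanZ; apply: fmean_le => w.
  have := frontier_gt0 t w; move: #|_| => m m0.
  have rl0 := r_ge0 l.+2.
  have rl2 : r l.+2 <= r 2.
    by elim: l {rl0} => // l IH; apply: le_trans (r_noninc _) IH.
  have r21 : r 2 / q <= 1 by rewrite ler_pdivrMr // mul1r r_noninc.
  have x0 : 0 <= r l.+2 / q by rewrite divr_ge0.
  have x2 : r l.+2 / q <= r 2 / q by rewrite ler_pM2r ?invr_gt0.
  rewrite -ler_pdivrMr ?exprn_gt0 // -exprVn -exprMn -[in leLHS]exprVn -exprMn.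
  rewrite -exprM.
  apply: (@le_trans _ _ ((r l.+2 / q) ^+ n.+1)).
    rewrite ler_wiXn2l ?leq_pmull //; exact: le_trans x2 r21.
  rewrite exprSr ler_wpM2r // lerXn2r //.
apply: nearW => M; rewrite sumEFin lee_fin.
case: M => [|M].
  rewrite big_geq // mulr_ge0 // addr_ge0 //.
  by apply: mulr_ge0; [apply: exprn_ge0 | apply: divr_ge0 => //; apply: mu_ge0].
rewrite big_nat_recl //= mulrDl mul1r; apply: lerD.
  by rewrite -jump_pos front_gfc.
apply: (@le_trans _ _ (\sum_(0 <= l < M) (r 2 / q) ^+ n * (r l.+2 / q) * front_gf t c)).
  by apply: ler_sum => l _; apply: step.
rewrite -mulr_suml ler_wpM2r // -mulr_sumr ler_wpM2l ?exprn_ge0 // -mulr_suml ler_wpM2r ?invr_ge0 //.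
by apply: le_trans (r_sum M.+1); rewrite big_nat_recl //= lerDr r_ge0.
Qed.

Lemma speed_upper eps : 0 <= eps -> eps < 1 ->
  (forall x, 0 <= x <= 1 ->
    \sum_(1 <= b < N) 'C(N, b)%:R * x ^+ b * ((1 + q ^+ (N - b)) ^+ N - 1) <=
    eps * ((1 + x) ^+ N - 1)) ->
  g <= (1 + (r 2 / q) ^+ n * (mu / q)) * (c ^+ N * 2 ^+ N * (1 - eps)^-1).
Proof.
move=> eps0 eps1 ex; set K := 1 + _; set D := _ * (1 - eps)^-1.
have K0 : 0 <= K.
  rewrite addr_ge0 //; apply: mulr_ge0; last by apply: divr_ge0 => //; apply: mu_ge0.
  by apply: exprn_ge0; apply: divr_ge0 => //; apply: r_ge0.
have bound m : travel_mean m <= m%:R * (K * D).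
  rewrite travel_mean_jumps; apply: (@le_trans _ _ (\sum_(0 <= t < m) (K * D))).
    apply: ler_sum => t _; apply: le_trans (jump_mean_le t) _.
    by rewrite ler_wpM2l // front_gf_le.
  by rewrite big_const_nat subn0 iter_addr_0 mulr_natl.
rewrite leNgt; apply/negP => lt.
have d0 : 0 < g - K * D by rewrite subr_gt0.
pose m := (Num.truncn (load_mean / (g - K * D))).+1.
have : load_mean / (g - K * D) < m%:R by apply: truncnS_gt.
rewrite ltr_pdivrMr // => h.
have /andP[_ gm] := gP (isT : (0 < m)%N); have := bound m.
lra.
Qed.

Lemma speed_lower : 1 <= n%:R * (1 / q - 1) * (1 - q) ->
  (c + (1 - c) * c) ^+ N - c ^+ N <= g.
Proof.
move=> hN; set h := _ - _.
(* The lower bound on the front holds from time 1 on, so the first increase is discarded. *)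
have bound m : m%:R * h <= travel_mean m.+1.
  rewrite travel_mean_jumps big_nat_recl //= -[leLHS]add0r lerD ?mean_ge0 //.
  rewrite mulr_natl -{1}[m]subn0 -iter_addr_0 -big_const_nat; apply: ler_sum => t _.
  by apply: le_trans (jump_mean_ge _); apply: front_gf_ge.
rewrite leNgt; apply/negP => lt.
have d0 : 0 < h - g by rewrite subr_gt0.
pose m := (Num.truncn (g / (h - g))).+1.
have : g / (h - g) < m%:R by apply: truncnS_gt.
rewrite ltr_pdivrMr // => hm.
have /andP[gm _] := gP (isT : (0 < m.+1)%N); have := bound m; rewrite -natr1 in gm.
lra.
Qed.

End RateBounds.

End Speed.

Lemma noise_speed : 0 < r 1 -> r 1 < 1 -> exists g : R,
  [/\ forall eps, 0 < eps -> {ae P, forall w, exists t0, forall t, (t0 <= t)%N ->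
        `|travel 0 t w - g * t%:R| <= eps * t%:R},
     1 <= n%:R * (1 / r 1 - 1) * (1 - r 1) ->
       let c := r 1 ^+ n.+1 in (c + (1 - c) * c) ^+ n.+1 - c ^+ n.+1 <= g &
     forall eps, 0 <= eps -> eps < 1 ->
       (forall x, 0 <= x <= 1 -> \sum_(1 <= b < n.+1) 'C(n.+1, b)%:R * x ^+ b *
          ((1 + r 1 ^+ (n.+1 - b)) ^+ n.+1 - 1) <= eps * ((1 + x) ^+ n.+1 - 1)) ->
       g <= (1 + (r 2 / r 1) ^+ n * (mu / r 1)) *
         ((r 1 ^+ n.+1) ^+ n.+1 * 2 ^+ n.+1 * (1 - eps)^-1)].
Proof.
move=> q0 q1; have [g gP] := speed_exists; exists g; split.
- by move=> eps eps0; apply: speed_ae.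
- exact: speed_lower.
- exact: speed_upper.
Qed.

End Noise.

(** * Asymptotics of the two bounds *)

Section Asymptotics.
Variable R : realType.
Implicit Types x q : R.

(** Write x^N = y^N y^N with y = sqrt x. One factor absorbs a power of N, as N y^N <= 1 + y + ... +
    y^(N - 1); the other serves the induction. *)
Lemma poly_geo_cvg0 (D : nat) x : 0 <= x -> x < 1 ->
  (fun N : nat => N%:R ^+ D * x ^+ N) @ \oo --> (0 : R).
Proof.
elim: D x => [|D IH] x x0 x1.
  under eq_fun do rewrite expr0 mul1r.
  by apply: cvg_expr; rewrite ger0_norm.
pose y := Num.sqrt x.
have y0 : 0 <= y by apply: sqrtr_ge0.
have y1 : y < 1 by rewrite -sqrtr1 ltr_sqrt.
have yx : y ^+ 2 = x by apply: sqr_sqrtr.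
have geo (N : nat) : N%:R * y ^+ N <= (1 - y)^-1.
  have d0 : 0 < 1 - y by rewrite subr_gt0.
  rewrite -[leRHS]mul1r ler_pdivlMr //.
  apply: (@le_trans _ _ (1 - y ^+ N)); last by rewrite lerBlDr lerDl exprn_ge0.
  rewrite -[X in _ <= X - _](expr1n _ N) subrXX mulrC ler_wpM2l ?(ltW d0) //.
  rewrite mulr_natl -[X in _ *+ X]card_ord -sumr_const; apply: ler_sum => i _.
  by rewrite expr1n mul1r ler_wiXn2l ?(ltW y1) ?(ltnW (ltn_ord i)).
have lim : (fun N : nat => (1 - y)^-1 * (N%:R ^+ D * y ^+ N)) @ \oo --> (0 : R).
  by rewrite -(mulr0 (1 - y)^-1); apply: cvgM; [exact: cvg_cst|exact: IH].
apply: (squeeze_cvgr _ (cvg_cst 0) lim).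
apply: nearW => N; rewrite mulr_ge0 ?exprn_ge0 //=.
have -> : N%:R ^+ D.+1 * x ^+ N = N%:R * y ^+ N * (N%:R ^+ D * y ^+ N).
  by rewrite -yx exprS -exprM mulnC muln2 -addnn exprD; ring.
by rewrite ler_wpM2r // mulr_ge0 ?exprn_ge0.
Qed.

Lemma cvg_shift1 (u : nat -> R) (l : R) : (fun N => u N.+1) @ \oo --> l -> u @ \oo --> l.
Proof. by rewrite cvg_shiftS. Qed.

(** The factor found in [excess_kernel_le], to be used as the [eps] of the supersolution. *)
Definition excess_rate q (D N : nat) : R :=
  2 * N%:R * ((1 + q) / 2) ^+ N.-1 +
  (1 + q) ^+ N * (2 * N%:R) ^+ D * ((1 + q ^+ D) / 2) ^+ N.-1.

Lemma excess_rate_cvg0 q : 0 < q -> q < 1 ->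
  exists2 D, (0 < D)%N & excess_rate q D @ \oo --> (0 : R).
Proof.
move=> q0 q1.
have q0' := ltW q0.
(* D is chosen so that ((1 + q^D) / 2)^N beats the crude factor (1 + q)^N. Any q^D < (1 - q) / 2
   works, since (1 + q) (3 - q) / 4 < 1. *)
have [D D0 hD] : exists2 D, (0 < D)%N & (1 + q) * ((1 + q ^+ D) / 2) < 1.
  have d0 : 0 < (1 - q) / 2 by lra.
  have qq : `|q| < 1 by rewrite ger0_norm.
  have /cvgrPdist_lt /(_ _ d0) [M _ hM] := cvg_expr qq.
  exists M.+1 => //; have := hM M.+1 (leqnSn M).
  rewrite /= sub0r normrN ger0_norm ?exprn_ge0 // => h.
  have : 0 <= q ^+ M.+1 by rewrite exprn_ge0.
  by move: (q ^+ M.+1) h => t h t0; nra.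
exists D => //.
set b1 := (1 + q) / 2; set b2 := (1 + q ^+ D) / 2 in hD.
have qD0 : 0 <= q ^+ D by rewrite exprn_ge0.
have b10 : 0 < b1 by rewrite /b1; lra.
have b11 : b1 < 1 by rewrite /b1; lra.
have b20 : 0 < b2 by rewrite /b2; lra.
have l1 := poly_geo_cvg0 1 (ltW b10) b11.
have x0 : 0 <= (1 + q) * b2 by rewrite mulr_ge0 // ?ltW //; lra.
have l2 := poly_geo_cvg0 D x0 hD.
have e : \forall N \near \oo, 2 / b1 * (N%:R ^+ 1 * b1 ^+ N) + 2 ^+ D / b2 * (N%:R ^+ D * ((1 + q) * b2) ^+ N)
    = excess_rate q D N.
  exists 1%N => // -[//|N] _; rewrite /excess_rate -/b1 -/b2 /=.
  have e1 : ((1 + q) * b2) ^+ N.+1 = (1 + q) ^+ N.+1 * (b2 * b2 ^+ N) by rewrite -exprS -exprMn.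
  have e2 : (2 * N.+1%:R : R) ^+ D = 2 ^+ D * N.+1%:R ^+ D by rewrite exprMn.
  have e3 : b1 ^+ N.+1 = b1 * b1 ^+ N by rewrite exprS.
  rewrite e1 e2 e3 expr1; move: (b1 ^+ N) (b2 ^+ N) => t1 t2.
  by field; rewrite !gt_eqF.
apply: cvg_trans (near_eq_cvg e) _.
have := cvgD (cvgM (@cvg_cst _ (2 / b1) nat \oo _) l1) (cvgM (@cvg_cst _ (2 ^+ D / b2) nat \oo _) l2).
by rewrite !mulr0 addr0; apply.
Qed.

Lemma speed_asymptotics q s m (g : nat -> R) : 0 < q -> q < 1 -> 0 <= s -> s < 1 ->
  (forall n, 1 <= n%:R * (1 / q - 1) * (1 - q) ->
     let c := q ^+ n.+1 in (c + (1 - c) * c) ^+ n.+1 - c ^+ n.+1 <= g n.+1) ->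
  (forall n eps, 0 <= eps -> eps < 1 ->
     (forall x, 0 <= x <= 1 -> \sum_(1 <= b < n.+1) 'C(n.+1, b)%:R * x ^+ b *
        ((1 + q ^+ (n.+1 - b)) ^+ n.+1 - 1) <= eps * ((1 + x) ^+ n.+1 - 1)) ->
     g n.+1 <= (1 + s ^+ n * m) * ((q ^+ n.+1) ^+ n.+1 * 2 ^+ n.+1 * (1 - eps)^-1)) ->
  (fun N : nat => g N / (q ^+ (N ^ 2) * 2 ^+ N)) @ \oo --> (1 : R).
Proof.
move=> q0 q1 s0 s1 lower upper.
have q0' := ltW q0.
have [D D0 hD] := excess_rate_cvg0 q0 q1.
apply: cvg_shift1.
have qpos (N : nat) : 0 < q ^+ N by rewrite exprn_gt0.
have two (N : nat) : 0 < 2 ^+ N :> R by rewrite exprn_gt0.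
(* With N = n + 1 and c = q^N, the lower bound divided by c^N 2^N is (1 - c / 2)^N - 2^(-N), and
   Bernoulli's inequality gives [lo]. The upper bound with eps = [excess_rate] gives [up]. *)
pose lo (n : nat) : R := 1 - 1 / 2 * (n.+1%:R ^+ 1 * q ^+ n.+1) - (1 / 2) ^+ n.+1.
pose up (n : nat) : R := (1 + s ^+ n * m) * (1 - excess_rate q D n.+1)^-1.
have hD1 : (fun n => excess_rate q D n.+1) @ \oo --> (0 : R) by rewrite cvg_shiftS.
have cvg_lo : lo @ \oo --> (1 : R).
  have g1 := poly_geo_cvg0 1 q0' q1.
  have h0 : `|1 / 2 : R| < 1 by rewrite ger0_norm; lra.
  have g2 := cvg_expr h0.
  have g1' : (fun n => n.+1%:R ^+ 1 * q ^+ n.+1) @ \oo --> (0 : R).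
    by rewrite (cvg_shiftS (fun n => n%:R ^+ 1 * q ^+ n)).
  have g2' : (fun n => (1 / 2 : R) ^+ n.+1) @ \oo --> (0 : R).
    by rewrite (cvg_shiftS (fun n => (1 / 2 : R) ^+ n)).
  have := cvgB (cvgB (@cvg_cst _ (1 : R) nat \oo _) (cvgM (@cvg_cst _ (1 / 2 : R) nat \oo _) g1')) g2'.
  by rewrite mulr0 !subr0; apply.
have cvg_up : up @ \oo --> (1 : R).
  have hs : `|s| < 1 by rewrite ger0_norm.
  have d := cvgB (@cvg_cst _ (1 : R) nat \oo _) hD1; rewrite subr0 in d.
  have := cvgM (cvgD (@cvg_cst _ (1 : R) nat \oo _) (cvgM (cvg_expr hs) (@cvg_cst _ m nat \oo _)))
    (cvgV (oner_neq0 R) (d _ _)).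
  by rewrite mul0r addr0 invr1 mulr1; apply.
apply: (squeeze_cvgr _ cvg_lo cvg_up).
have small : \forall n \near \oo, `|0 - excess_rate q D n.+1| < 1 / 2.
  by move/cvgrPdist_lt : hD1; apply; lra.
have kpos : 0 < (1 / q - 1) * (1 - q).
  by rewrite mulr_gt0 // subr_gt0 // ltr_pdivlMr // mul1r.
near=> n.
have ex_ge0 : 0 <= excess_rate q D n.+1.
  have qD0 : 0 <= q ^+ D by rewrite exprn_ge0.
  apply: addr_ge0; first by rewrite !mulr_ge0 ?exprn_ge0 //; lra.
  by rewrite !mulr_ge0 ?exprn_ge0 ?mulr_ge0 //; lra.
have ex_lt : excess_rate q D n.+1 < 1 / 2.
  have : `|0 - excess_rate q D n.+1| < 1 / 2 by near: n.
  by rewrite sub0r normrN ger0_norm.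
have an0 : 0 < q ^+ (n.+1 ^ 2) * 2 ^+ n.+1 by rewrite mulr_gt0.
rewrite ler_pdivlMr // ler_pdivrMr //.
have e2 : q ^+ (n.+1 ^ 2) = (q ^+ n.+1) ^+ n.+1 by rewrite -mulnn exprM.
apply/andP; split.
  apply: le_trans (lower n _); last first.
    rewrite -mulrA -ler_pdivrMr //.
    near: n; exact: nbhs_infty_ger.
  rewrite e2 /=; set c := q ^+ n.+1.
  have c0 : 0 <= c by rewrite exprn_ge0.
  have c1 : c <= 1 by rewrite exprn_ile1 // ltW.
  have -> : (c + (1 - c) * c) ^+ n.+1 = c ^+ n.+1 * 2 ^+ n.+1 * (1 - c / 2) ^+ n.+1.
    by rewrite -!exprMn; congr (_ ^+ _); field.
  have bern : 1 - n.+1%:R * (c / 2) <= (1 - c / 2) ^+ n.+1.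
    elim: (n.+1) => [|k IHk]; first by rewrite mul0r subr0 expr0.
    rewrite exprS -natr1; have c2 : 0 <= 1 - c / 2 by lra.
    apply: le_trans (ler_wpM2l c2 IHk).
    have : 0 <= k%:R * (c / 2 * (c / 2)) by rewrite !mulr_ge0 //; lra.
    by nra.
  have half : (1 / 2) ^+ n.+1 * 2 ^+ n.+1 = 1 :> R.
    by rewrite -exprMn (_ : 1 / 2 * 2 = 1) ?expr1n //; field.
  have cc0 : 0 <= c ^+ n.+1 * 2 ^+ n.+1 by rewrite mulr_ge0 ?exprn_ge0.
  have := ler_wpM2l cc0 bern.
  rewrite /lo expr1 -/c; move: half.
  move: ((1 / 2) ^+ n.+1) (c ^+ n.+1) (2 ^+ n.+1) ((1 - c / 2) ^+ n.+1) => H C T B half.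
  have -> : (1 - 1 / 2 * (n.+1%:R * c) - H) * (C * T) =
     C * T * (1 - n.+1%:R * (c / 2)) - C * (H * T) by field.
  by rewrite half mulr1; lra.
have ex1 : excess_rate q D n.+1 < 1 by lra.
apply: le_trans (upper n _ ex_ge0 ex1 _) _.
  move=> x /andP[x0 x1]; exact: excess_kernel_le.
rewrite e2 /up le_eqVlt; apply/orP; left; apply/eqP.
by rewrite -[RHS]mulrA; congr (_ * _); rewrite mulrC.
Unshelve. all: by end_near.
Qed.

End Asymptotics.

(** * The max-plus model *)

Section MaxPlusTime.
Context (R : realType) (d : measure_display) (T : measurableType d).

Lemma maxN_ge (n : nat) (f : 'I_n.+1 -> R) i : f i <= maxN f.
Proof.
rewrite /maxN; have : f i \in [seq f j | j <- enum 'I_n.+1] by rewrite map_f // mem_enum.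
case: [seq _ | _ <- _] => [//|a s].
elim: s a => [|b s IH] a; first by rewrite inE => /eqP ->.
rewrite /= !inE le_max => /or3P[/eqP e|/eqP ->|h].
- by apply/orP; right; apply: IH; rewrite inE e eqxx.
- by rewrite lexx.
- by apply/orP; right; apply: IH; rewrite inE h orbT.
Qed.

Lemma maxN_ex (n : nat) (f : 'I_n.+1 -> R) : exists i, maxN f = f i.
Proof.
rewrite /maxN; have : [seq f j | j <- enum 'I_n.+1] != [::].
  by rewrite -size_eq0 size_map size_enum_ord.
have : {subset [seq f j | j <- enum 'I_n.+1] <= [seq f j | j <- enum 'I_n.+1]} by [].
case: {1 3 4}[seq _ | _ <- _] => [//|a s] sub _.
suff /sub /mapP[i _ ->] : foldr Num.max a s \in a :: s by exists i.
elim: s {sub} => [|b s IH]; first by rewrite inE.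
rewrite /= maxEle; case: ifP => _; last by rewrite !inE eqxx orbT.
by move: IH; rewrite !inE => /orP[->|->]; rewrite ?orbT.
Qed.

Variables (n : nat) (K : R) (X0 : 'I_n.+1 -> R).
Variables (x : 'I_n.+1 -> 'I_n.+1 -> nat -> T -> R).
Variables (H : nat -> T -> {ffun 'I_n.+1 * 'I_n.+1 -> nat}) (w : T).
Hypothesis xH : forall i j s, x i j s w = K - (H s w (i, j))%:R.
Let B0 := \sum_i `|X0 i|.

(** The initial vector perturbs the state by a bounded amount for all time, since maxima and
    translations do not expand the uniform distance. *)
Lemma maxplusX_passage t i :
  `|maxplusX X0 x t w i - (K * t%:R - (minplus_run (flat n 0) (seg H 0 t w) i)%:R)| <= B0.
Proof.
elim: t i => [|t IH] i.
  rewrite mulr0 sub0r /= ffunE oppr0 subr0 /B0 (bigD1 i) //= lerDl.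
  by rewrite sumr_ge0.
rewrite seg_S minplus_run_rcons /=.
set y := minplus_run _ _ in IH *.
rewrite ler_norml -natr1 mulrDr mulr1; apply/andP; split.
  have [j hj] := minplus_step_ex y (H t w) i.
  have := maxN_ge (fun j => maxplusX X0 x t w j + x i j t w) j.
  have := IH j; rewrite ler_norml xH hj natrD => /andP[h _]; lra.
have [j ->] := maxN_ex (fun j => maxplusX X0 x t w j + x i j t w).
have := minplus_step_le y (H t w) i j; rewrite -(ler_nat R) natrD => h1.
have := IH j; rewrite ler_norml xH => /andP[_ h]; lra.
Qed.

Lemma maxN_passage t :
  `|maxN (maxplusX X0 x t w) - (K * t%:R - travel R H 0 t w)| <= B0.
Proof.
rewrite ler_norml; apply/andP; split.
  have [j hj] := ffmin_ex (minplus_run (flat n 0) (seg H 0 t w)).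
  have := maxN_ge (maxplusX X0 x t w) j; have := maxplusX_passage t j.
  rewrite /travel /passage hj ler_norml => /andP[h _]; lra.
have [j ->] := maxN_ex (maxplusX X0 x t w).
have := ffmin_le (minplus_run (flat n 0) (seg H 0 t w)) j; rewrite -(ler_nat R).
have := maxplusX_passage t j.
rewrite /travel /passage ler_norml => /andP[_ h]; lra.
Qed.

(** The tolerances 1 / (m + 1) form a countable family, so almost sure statements can be intersected
    beforehand. Half of eps is spent on the passage time and half on the initial vector. *)
Lemma maxplus_speed_cvg g :
  (forall m : nat, exists t0, forall t, (t0 <= t)%N ->
     `|travel R H 0 t w - g * t%:R| <= m.+1%:R^-1 * t%:R) ->
  (fun t : nat => (t%:R)^-1 * maxN (maxplusX X0 x t w)) @ \oo --> K - g.
Proof.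
move=> h; apply/cvgrPdist_le => eps eps0.
have [t0 ht] := h (Num.truncn (2 / eps)).
have B00 : 0 <= B0 by apply: sumr_ge0.
exists (maxn t0 (Num.truncn (2 * B0 / eps)).+1) => // t /=; rewrite geq_max => /andP[t1 t2].
have tpos : 0 < t%:R :> R by rewrite ltr0n (leq_trans _ t2).
have {}t2 : 2 * B0 <= t%:R * eps.
  rewrite -ler_pdivrMr //; apply: ltW; apply: lt_le_trans (truncnS_gt _) _.
  by rewrite ler_nat.
have e2 : (Num.truncn (2 / eps)).+1%:R^-1 <= eps / 2.
  rewrite -[leRHS]invrK lef_pV2 ?posrE ?invr_gt0 ?divr_gt0 // invf_div.
  by apply: ltW; apply: truncnS_gt.
have := ht t t1; have := maxN_passage t.
set M := maxN _; set D := travel _ _ _ _ _ => a1 a2.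
rewrite -(ler_pM2r tpos).
have -> : `|K - g - t%:R^-1 * M| * t%:R = `|(K - g) * t%:R - M|.
  rewrite -[X in _ * X](ger0_norm (ltW tpos)) -normrM mulrBl; congr (`|_ - _|).
  by rewrite mulrAC mulVf ?gt_eqF // mul1r.
have {}e2 : (Num.truncn (2 / eps)).+1%:R^-1 * t%:R <= eps / 2 * t%:R by rewrite ler_wpM2r // ltW.
move: a1 (le_trans a2 e2); rewrite !ler_norml => /andP[b1 b2] /andP[b3 b4].
move: b1 b2 b3 b4 t2; clear; move: M D B0 (t%:R) => M D B s b1 b2 b3 b4 t2.
by apply/andP; split; lra.
Qed.

End MaxPlusTime.

(** * The law of k - xi *)

Section Depth.
Context (d : measure_display) (T : measurableType d) (R : realType) (P : probability T R).
Variables (k : int) (p : int -> R).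
Hypothesis p_ge0 : forall l, 0 <= p l.
Hypothesis p_sum : (fun n : nat => \sum_(0 <= m < n) p (k - m%:Z)) @ \oo --> (1 : R).
Let F (m : nat) := \sum_(0 <= i < m) p (k - i%:Z).
Let r (m : nat) := 1 - F m.

(* The integer k - xi, forced to be nonnegative off the almost sure event. *)
Definition depth (y : R) : nat := Num.truncn (k%:~R - y).

Lemma depth_measurable (X : set nat) : measurable (depth @^-1` X : set R).
Proof.
have mlt m : measurable [set y : R | (m < depth y)%N].
  rewrite (_ : [set y | _] = [set` `]-oo, k%:~R - m.+1%:R]]); first exact: measurable_itv.
  by apply/seteqP; split => y /=; rewrite /depth truncn_gt_nat in_itv /= lerBrDr lerBrDl addrC.
have mle m : measurable [set y : R | (m <= depth y)%N].
  case: m => [|m]; last exact: mlt.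
  by rewrite (_ : [set y | _] = setT) //; apply/seteqP.
rewrite (_ : depth @^-1` X = \bigcup_(m in X) ([set y | (m <= depth y)%N] `\` [set y | (m < depth y)%N])).
  by apply: bigcup_measurable => m _; apply: measurableD.
apply/seteqP; split => [y Xy|y [m Xm [/= h1 /negP]]].
  by exists (depth y) => //; split => //=; rewrite ltnn.
by rewrite -leqNgt => h2; have -> : depth y = m by apply/eqP; rewrite eqn_leq h1 h2.
Qed.

Section OneVariable.
Variable x : T -> R.
Hypothesis mx : measurable_fun setT x.
Hypothesis x_law : forall l, l <= k -> P (x @^-1` [set (l%:~R : R)]) = (p l)%:E.

Lemma depth_rv : discrete_rv (depth \o x).
Proof.
move=> X; rewrite comp_preimage -[X in measurable X]setTI.
by apply: mx => //; apply: depth_measurable.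
Qed.

Let lev m := x @^-1` [set ((k - m%:Z)%:~R : R)].

Let lev_prob m : prob P (lev m) = p (k - m%:Z).
Proof. by rewrite /prob x_law ?lerBlDr ?lerDl. Qed.

Let lev_measurable m : measurable (lev m).
Proof. by rewrite -[X in measurable X]setTI; apply: mx => //; apply: measurable_set1. Qed.

Let lev_sub m : lev m `<=` [set w | depth (x w) = m].
Proof.
by move=> w /= ->; rewrite /depth rmorphB /= opprB addrC subrK -pmulrn natrK.
Qed.

Let meq m : measurable [set w | depth (x w) = m].
Proof. exact: (depth_rv [set m]). Qed.

Let mltn m : measurable [set w | (depth (x w) < m)%N].
Proof. exact: (depth_rv [set j | (j < m)%N]). Qed.

Let prob_lt m : prob P [set w | (depth (x w) < m)%N] =
  \sum_(0 <= i < m) prob P [set w | depth (x w) = i].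
Proof.
elim: m => [|m IH].
  rewrite big_geq // (_ : [set w | _] = set0) ?/prob ?measure0 //.
  by apply/seteqP; split.
rewrite big_nat_recr //= -IH; apply: EFin_inj; rewrite EFinD -!probE // -measureU //.
  congr (P _); apply/seteqP; split => w /=.
    by rewrite ltnS leq_eqVlt => /orP[/eqP|]; [right|left].
  by case=> [/ltnW|->].
by apply/seteqP; split => w //= [h e]; rewrite e ltnn in h.
Qed.

(** The atom of xi at k - m lies in the event that the depth is m, which gives one inequality. As
    the p already sum to 1, an excess at one m would push the total mass above 1. *)
Lemma depth_law m : prob P [set w | depth (x w) = m] = p (k - m%:Z).
Proof.
have ge i : p (k - i%:Z) <= prob P [set w | depth (x w) = i].
  by rewrite -lev_prob; apply: prob_le.
apply/eqP; rewrite eq_le ge andbT leNgt; apply/negP => lt.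
have d0 : 0 < prob P [set w | depth (x w) = m] - p (k - m%:Z) by rewrite subr_gt0.
move/cvgrPdist_lt : (p_sum) => /(_ _ d0)[M _ hM].
have := hM (M + m.+1)%N (leq_addr _ _); rewrite /= => /ltr_normlW.
have h1 : prob P [set w | (depth (x w) < M + m.+1)%N] <= 1 by apply: prob_le1.
rewrite prob_lt in h1.
have : prob P [set w | depth (x w) = m] - p (k - m%:Z) <=
    \sum_(0 <= i < M + m.+1) (prob P [set w | depth (x w) = i] - p (k - i%:Z)).
  rewrite (big_cat_nat (n := m)) //=; last by rewrite addnS ltnW // ltnS leq_addl.
  rewrite (@big_ltn _ _ _ m) /=; last by rewrite addnS ltnS leq_addl.
  by rewrite addrCA lerDl addr_ge0 // sumr_ge0 // => i _; rewrite subr_ge0.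
rewrite sumrB; lra.
Qed.

Lemma depth_tail m : prob P [set w | (m <= depth (x w))%N] = r m.
Proof.
rewrite (_ : [set w | _] = ~` [set w | (depth (x w) < m)%N]); last first.
  by apply/seteqP; split => w /= => [h|/negP]; [apply/negP|]; rewrite -leqNgt.
have mC : measurable (~` [set w | (depth (x w) < m)%N]) by apply: measurableC.
apply: EFin_inj; rewrite -probE // probability_setC // probE // -EFinB.
by congr EFin; rewrite prob_lt /r /F; congr (_ - _); apply: eq_bigr => i _; apply: depth_law.
Qed.

(** Each atom of xi has the same probability as the level set of [depth] containing it, and there
    are countably many levels. *)
Lemma depth_exact : {ae P, forall w, x w = k%:~R - (depth (x w))%:R}.
Proof.
apply: (@negligibleS _ _ _ P (\bigcup_m ([set w | depth (x w) = m] `\` lev m))).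
  move=> w /= nw; exists (depth (x w)) => //; split => //= e; apply: nw.
  by rewrite /= {1}e rmorphB.
apply: negligible_bigcup => m.
have mD : measurable ([set w | depth (x w) = m] `\` lev m) by apply: measurableD.
have : prob P [set w | depth (x w) = m] =
    prob P ([set w | depth (x w) = m] `\` lev m) + prob P (lev m).
  apply: EFin_inj; rewrite EFinD -!probE // -measureU //.
    by congr (P _); rewrite setUC setDUK //; apply: lev_sub.
  by rewrite setDE -setIA setICl setI0.
rewrite depth_law lev_prob => e.
have P0 : P ([set w | depth (x w) = m] `\` lev m) = 0%E.
  by rewrite probE //; congr EFin; move: e; lra.
by exists ([set w | depth (x w) = m] `\` lev m); split; [exact: mD|exact: P0|exact: subset_refl].
Qed.

End OneVariable.

Let F_mono m m' : (m <= m')%N -> F m <= F m'.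
Proof.
by move=> mm; rewrite /F (big_cat_nat (n := m) _ mm) //= lerDl sumr_ge0.
Qed.

(** Tails sum to a first moment, and i <= |k - i| + |k|. Each tail is replaced by [F M - F l.+1] for
    a late M, with an error of e / (m + 1) in each of the m terms. *)
Lemma depth_tail_sum : cvg ((fun n : nat => \sum_(0 <= m < n) p (k - m%:Z) * `|(k - m%:Z)%:~R : R|) @ \oo) ->
  exists mu : R, forall m, \sum_(0 <= l < m) r l.+1 <= mu.
Proof.
set S := fun n => _; move=> cS.
have S_le N : S N <= limn S.
  apply: nondecreasing_cvgn_le => // a b ab.
  by rewrite /S (big_cat_nat (n := a) _ ab) //= lerDl sumr_ge0 // => i _; rewrite mulr_ge0.
have F_le N : F N <= 1.
  rewrite -(cvg_lim _ p_sum) //; apply: nondecreasing_cvgn_le; first by move=> a b; apply: F_mono.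
  by apply/cvg_ex; exists 1.
exists (limn S + `|k%:~R|) => m.
have weight N : \sum_(0 <= i < N) i%:R * p (k - i%:Z) <= limn S + `|k%:~R|.
  apply: (@le_trans _ _ (S N + `|k%:~R| * F N)).
    rewrite /S /F mulr_sumr -big_split /=; apply: ler_sum => i _.
    rewrite [X in _ <= X + _]mulrC -mulrDl ler_wpM2r //.
    have -> : i%:R = `|(k - i%:Z)%:~R - k%:~R : R|.
      by rewrite rmorphB /= addrAC subrr add0r normrN -pmulrn normr_nat.
    by apply: le_trans (ler_normB _ _) _.
  by rewrite lerD // ler_piMr.
have tail l N : F N - F l.+1 <= \sum_(0 <= i < N) (l < i)%N%:R * p (k - i%:Z).
  elim: N => [|N IH]; first by rewrite [leRHS]big_geq // subr_le0; apply: F_mono.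
  have [lN|Nl] := ltnP l N.
    rewrite [leRHS]big_nat_recr //= lN mul1r {1}/F big_nat_recr //= -/(F N).
    by rewrite addrAC lerD2r.
  apply: (@le_trans _ _ 0); first by rewrite subr_le0 F_mono.
  by rewrite sumr_ge0 // => i _; rewrite mulr_ge0.
have key N : \sum_(0 <= l < m) (F N - F l.+1) <= limn S + `|k%:~R|.
  apply: le_trans (weight N).
  apply: (@le_trans _ _ (\sum_(0 <= l < m) \sum_(0 <= i < N) (l < i)%N%:R * p (k - i%:Z))).
    by apply: ler_sum => l _; apply: tail.
  rewrite exchange_big /=; apply: ler_sum => i _; rewrite -mulr_suml ler_wpM2r //.
  rewrite -natr_sum ler_nat.
  elim: m i => [|m IH] i; first by rewrite big_geq.
  rewrite big_nat_recl //=; case: i => [|i]; first by rewrite big1.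
  by rewrite add1n ltnS; apply: IH.
apply/ler_addgt0Pl => e e0.
have d0 : 0 < e / m.+1%:R by rewrite divr_gt0.
move/cvgrPdist_lt : (p_sum) => /(_ _ d0)[M _ hM].
have := hM M (leqnn M); rewrite /= -/(F M) => /ltr_normlW hF.
apply: (@le_trans _ _ (\sum_(0 <= l < m) (e / m.+1%:R + (F M - F l.+1)))).
  apply: ler_sum => l _; rewrite /r; move: hF.
  by move: (e / m.+1%:R) (F M) (F l.+1) => a b c; lra.
rewrite big_split /= lerD //.
rewrite big_const_nat subn0 iter_addr_0 -[leLHS]mulr_natr mulrAC ler_pdivrMr //.
by rewrite ler_wpM2l ?(ltW e0) // ler_nat.
Qed.

End Depth.

(** * The noise matrices of the model *)

Section NoiseOfDepth.
Context (d : measure_display) (T : measurableType d) (R : realType) (P : probability T R).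
Variables (k : int) (p : int -> R) (n : nat).
Variable x : 'I_n.+1 -> 'I_n.+1 -> nat -> T -> R.
Hypothesis p_ge0 : forall l, 0 <= p l.
Hypothesis p_sum : (fun n : nat => \sum_(0 <= m < n) p (k - m%:Z)) @ \oo --> (1 : R).
Hypothesis mx : forall i j s, measurable_fun setT (x i j s).
Hypothesis x_law : forall i j s l, l <= k -> P (x i j s @^-1` [set (l%:~R : R)]) = (p l)%:E.
Hypothesis x_indep : mutually_independent_rvs P
  (fun ijs : 'I_n.+1 * 'I_n.+1 * nat => x ijs.1.1 ijs.1.2 ijs.2).
Local Notation E := {ffun 'I_n.+1 * 'I_n.+1 -> nat}.

Definition depth_noise (s : nat) (w : T) : E :=
  [ffun ij => depth k (x ij.1 ij.2 s w)].

Let cell (c : 'I_n.+1 * 'I_n.+1 * nat) : T -> nat := fun w => depth k (x c.1.1 c.1.2 c.2 w).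

Let cell_rv c : discrete_rv (cell c).
Proof. exact: depth_rv. Qed.

Let depth_indep (J : seq ('I_n.+1 * 'I_n.+1 * nat)) (B : 'I_n.+1 * 'I_n.+1 * nat -> set nat) :
  uniq J -> prob P [set w | forall c, c \in J -> B c (cell c w)] =
  \prod_(c <- J) prob P (cell c @^-1` B c).
Proof.
move=> uJ; apply: EFin_inj; rewrite -prodEFin.
have -> : [set w | forall c, c \in J -> B c (cell c w)] =
    \big[setI/setT]_(c <- J) (x c.1.1 c.1.2 c.2 @^-1` (depth k @^-1` B c)).
  by rewrite -bigcap_seq; apply/seteqP; split => w h c; apply: h.
rewrite -probE; last first.
  by apply: bigsetI_measurable => c _; apply: (cell_rv c (B c)).
rewrite (x_indep (B := fun c => depth k @^-1` B c) uJ); last by move=> c; apply: depth_measurable.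
by apply: eq_bigr => c _; rewrite -probE //; apply: (cell_rv c (B c)).
Qed.

Lemma depth_noise_rv s : discrete_rv (depth_noise s).
Proof.
apply: discrete_rv_fibers => e.
have -> : depth_noise s @^-1` [set e] =
    \big[setI/setT]_(ij <- enum {: 'I_n.+1 * 'I_n.+1}) (cell (ij, s) @^-1` [set e ij]).
  rewrite -bigcap_seq; apply/seteqP; split => w /= h.
    by move=> ij _; rewrite /= -h ffunE.
  by apply/ffunP => ij; rewrite ffunE; apply: (h ij); rewrite /= mem_enum.
by apply: bigsetI_measurable => ij _; apply: cell_rv.
Qed.

Lemma depth_noise_law (l : seq (nat * E)) : uniq (unzip1 l) ->
  prob P [set w | all (fun te => depth_noise te.1 w == te.2) l] =
  \prod_(te <- l) \prod_(ij : 'I_n.+1 * 'I_n.+1) p (k - (te.2 ij)%:Z).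
Proof.
move=> ul.
pose J := [seq (ij, t) | t <- unzip1 l, ij <- index_enum ('I_n.+1 * 'I_n.+1)%type].
(* The matrix prescribed at time t; the lookup is unambiguous because the times in [l] are
   distinct. *)
pose e_of (t : nat) : E := nth [ffun=> 0%N] (unzip2 l) (index t (unzip1 l)).
have e_ofE te : te \in l -> e_of te.1 = te.2.
  move=> /(nthP te)[i il <-]; rewrite /e_of.
  rewrite -(nth_map te 0%N (fun y => y.1)) // index_uniq ?size_map //.
  by rewrite -(nth_map te [ffun=> 0%N] (fun y => y.2)).
have uJ : uniq J.
  apply: allpairs_uniq => //; first exact: index_enum_uniq.
  by move=> [t ij] [t' ij'] _ _ [-> ->].
transitivity (prob P [set w | forall c, c \in J -> [set e_of c.2 c.1] (cell c w)]).
  congr prob; apply/seteqP; split => w /= h.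
    move=> c /allpairsP[[t ij] /= [/mapP[te tel ->] _ ->]] /=.
    by rewrite e_ofE // /cell /= -(eqP (allP h te tel)) ffunE.
  apply/allP => te tel; apply/eqP/ffunP => ij; rewrite ffunE -e_ofE //.
  apply: (h (ij, te.1)); apply/allpairsP; exists (te.1, ij); split => //=.
    exact: map_f.
  exact: mem_index_enum.
rewrite (depth_indep (fun c => [set e_of c.2 c.1]) uJ) big_allpairs_dep big_map.
rewrite !big_seq; apply: eq_bigr => te tel; apply: eq_bigr => ij _ /=.
by rewrite e_ofE //; apply: (depth_law p_sum (mx ij.1 ij.2 te.1) (x_law ij.1 ij.2 te.1)).
Qed.

Lemma depth_noise_tail t (A : {set 'I_n.+1 * 'I_n.+1}) l :
  prob P [set w | [forall c in A, (l <= depth_noise t w c)%N]] =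
  (1 - \sum_(0 <= i < l) p (k - i%:Z)) ^+ #|A|.
Proof.
pose J := [seq (c, t) | c <- enum A].
have uJ : uniq J by rewrite map_inj_uniq ?enum_uniq // => c c' [].
transitivity (prob P [set w | forall c, c \in J -> [set m | (l <= m)%N] (cell c w)]).
  congr prob; apply/seteqP; split => w /= h.
    move=> c /mapP[ij ijA ->]; rewrite mem_enum in ijA.
    by have /implyP/(_ ijA) := forallP h ij; rewrite ffunE.
  apply/forallP => ij; apply/implyP => ijA; rewrite ffunE.
  by apply: (h (ij, t)); apply: map_f; rewrite mem_enum.
rewrite (depth_indep (fun=> [set m | (l <= m)%N]) uJ) big_map big_enum /=.
rewrite -prodr_const; apply: eq_bigr => c _.
exact: (depth_tail p_sum (mx c.1 c.2 t) (x_law c.1 c.2 t) l).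
Qed.

(** The triples (i, j, s) are countable, so the null sets of the single entries can be united along
    [unpickle]. *)
Lemma depth_noise_exact : {ae P, forall w, forall i j s,
  x i j s w = k%:~R - (depth_noise s w (i, j))%:R}.
Proof.
pose Q (m : nat) w := if unpickle m is Some c then
  x c.1.1 c.1.2 c.2 w = k%:~R - (cell c w)%:R else True.
have hQ : \forall w \ae P, forall m, Q m w.
  apply: ae_foralln => m; rewrite /Q; case: (unpickle m) => [c|]; last exact: nearW.
  exact: (depth_exact p_sum (mx c.1.1 c.1.2 c.2) (x_law c.1.1 c.1.2 c.2)).
apply: filterS hQ => w h i j s; have := h (pickle (i, j, s)).
by rewrite /Q pickleK ffunE.
Qed.

End NoiseOfDepth.

Theorem theorem6p1 (R : realType) (d : measure_display) (T : measurableType d)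
  (P : probability T R) (k : int) (p : int -> R)
  (xi : forall N : nat, 'I_N -> 'I_N -> nat -> T -> R)
  (X0 : forall N : nat, 'I_N -> R) :
  (forall l, 0 <= p l) ->
  (forall l, (k < l)%R -> p l = 0) ->
  (fun n : nat => \sum_(0 <= m < n) p (k - m%:Z)) @ \oo --> (1 : R) ->
  0 < p k < 1 ->
  0 < p k * p (k - 1) ->
  cvg ((fun n : nat => \sum_(0 <= m < n) p (k - m%:Z) * `|(k - m%:Z)%:~R : R|) @ \oo) ->
  (forall N i j s, measurable_fun setT (xi N i j s)) ->
  (forall N i j s l, (l <= k)%R ->
     P (xi N i j s @^-1` [set (l%:~R : R)]) = (p l)%:E) ->
  (forall N, mutually_independent_rvs P
     (fun ijs : 'I_N * 'I_N * nat => xi N ijs.1.1 ijs.1.2 ijs.2)) ->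
  exists v : nat -> R,
    (forall N, (1 <= N)%N ->
       {ae P, forall w, (fun t : nat =>
          (t%:R)^-1 * maxN (maxplusX (X0 N) (xi N) t w)) @ \oo --> v N}) /\
    (fun N : nat =>
       (v N - (k%:~R - (1 - p k) ^+ (N ^ 2) * 2 ^+ N)) /
       ((1 - p k) ^+ (N ^ 2) * 2 ^+ N)) @ \oo --> (0 : R).
Proof.
move=> p_ge0 _ p_sum /andP[pk0 pk1] ppk p_mean mx x_law x_indep.
have pk' : 0 < p (k - 1) by rewrite pmulr_rgt0 in ppk.
pose r (l : nat) : R := 1 - \sum_(0 <= i < l) p (k - i%:Z).
have r1 : r 1 = 1 - p k by rewrite /r big_nat1 subr0.
have r2 : r 2 = 1 - p k - p (k - 1).
  by rewrite /r big_nat_recr //= big_nat1 subr0 opprD addrA.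
have q0 : 0 < r 1 by rewrite r1 subr_gt0.
have q1 : r 1 < 1 by rewrite r1 ltrBlDr ltrDl.
have [mu r_sum] := depth_tail_sum p_ge0 p_sum p_mean.
have /choice[g hg] := fun n => noise_speed
  (nu := fun e : {ffun 'I_n.+1 * 'I_n.+1 -> nat} => \prod_ij p (k - (e ij)%:Z)) (r := r)
  (depth_noise_rv k (mx n.+1))
  (depth_noise_law p_sum (mx n.+1) (x_law n.+1) (x_indep n.+1))
  (depth_noise_tail p_sum (mx n.+1) (x_law n.+1) (x_indep n.+1))
  r_sum q0 q1.
have r2_ge0 : 0 <= r 2.
  have := depth_noise_tail p_sum (mx 1) (x_law 1) (x_indep 1) 0 (finset.set1 (ord0, ord0)) 2.
  by rewrite finset.cards1 expr1 -/(r 2) => <-; apply: prob_ge0.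
(* [g n] is the speed for size n + 1, hence the predecessor; the value at N = 0 is arbitrary. *)
exists (fun N => k%:~R - g N.-1); split.
  case=> // n _.
  have [speed _ _] := hg n.
  have speeds := ae_foralln (fun m => speed m.+1%:R^-1 (ltac:(by rewrite invr_gt0))).
  have exact := depth_noise_exact p_sum (mx n.+1) (x_law n.+1).
  by apply: filterS2 exact speeds => w xw sw; exact: (maxplus_speed_cvg (X0 n.+1) xw sw).
have ratio : (fun N : nat => g N.-1 / (r 1 ^+ (N ^ 2) * 2 ^+ N)) @ \oo --> (1 : R).
  apply: (@speed_asymptotics R (r 1) (r 2 / r 1) (mu / r 1) (fun N => g N.-1)) => //.
  - by rewrite divr_ge0 // ltW.
  (* Positivity of p (k - 1) enters here: it makes r 2 / r 1 < 1, so that increases beyond 1 are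
     negligible. *)
  - by rewrite ltr_pdivrMr // mul1r r1 r2 ltrBlDr ltrDl.
  - by move=> n; have [_ lower _] := hg n.
  - by move=> n; have [_ _ upper] := hg n.
rewrite -r1.
have -> : (fun N : nat => (k%:~R - g N.-1 - (k%:~R - r 1 ^+ (N ^ 2) * 2 ^+ N)) /
    (r 1 ^+ (N ^ 2) * 2 ^+ N)) = (fun N => 1 - g N.-1 / (r 1 ^+ (N ^ 2) * 2 ^+ N)).
  apply/funext => N; set a := r 1 ^+ _ * _.
  have a0 : a != 0 by rewrite gt_eqF // mulr_gt0 // exprn_gt0.
  rewrite -[X in X - _ / _](mulfV a0) -mulrBl; congr (_ / _).
  by rewrite opprB addrCA addrAC subrr add0r.
have := cvgB (@cvg_cst _ (1 : R) nat \oo _) ratio.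
by rewrite subrr; apply.
Qed.
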